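(* Let $f$ be a block function on $(\omega,<)$ which is not intrinsically computable on a cone and such that, after some initial segment, every $f$-block embeds into some later $f$-block. Let $\Gamma$ be a Turing functional such that for every $A\subseteq\omega$, $\Gamma^A:\omega^3\to\{0,1\}$ is total, for each $e$ the set $X_e^A(x)=\lim_s\Gamma^A(e,x,s)$ is defined (so $(X_e^A)_{e\in\omega}$ is a uniformly $A$-computable list of approximations to $\Delta^0_2(A)$ sets), and $A\le_T X_e^A$ for each $e$. Then there is $Z$ such that for every $A\ge_T Z$, $\mathrm{DgSp}^A(f)$ contains some degree which is not the degree of any $X_e^A$, $e\in\omega$.
   Context: A copy of $(\omega,<)$ is a linear order $\mathcal{L}=(L,\prec)$ with $L\subseteq\omega$ isomorphic to $(\omega,<)$; it is $X$-computable if $L,\prec$ are $X$-computable. With $\pi_{\mathcal{L}}:\mathcal{L}\to(\omega,<)$ the unique isomorphism, $f^{\mathcal{L}}=\pi_{\mathcal{L}}^{-1}\circ f\circ\pi_{\mathcal{L}}$, and $\mathrm{DgSp}^X(f)=\{\deg_T(f^{\mathcal{L}}\oplus X):\mathcal{L}\text{ an }X\text{-computable copy of }(\omega,<)\}$. $f$ is intrinsically computable on a cone if there is $X$ with $\mathrm{DgSp}^Y(f)=\{\deg_T(Y)\}$ for all $Y\ge_T X$. A function $f:\omega\to\omega$ is a block function if every $n$ lies in a finite interval $[a,b]$ with $f([a,b])\subseteq[a,b]$ and $f^{-1}([a,b])\subseteq[a,b]$; the minimal such interval is the $f$-block of $n$. An $f$-block $B$ embeds into an $f$-block $C$ if there is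 an order-preserving injection $h:B\to C$ with $h(f(x))=f(h(x))$; $C$ is later than $B$ if all its elements exceed those of $B$. *)

(* Defs.v *)
From Stdlib Require Import Arith Cantor.

Notation "'<|' x , y '|>'" := (Cantor.to_nat (x, y)) (at level 0, x, y at level 99).

(* Partial recursive functionals, as unary functions with tuples coded by
   pairing.  The identity is [Pair Fst Snd]. *)
Inductive functional : Set :=
| Zero | Succ | Fst | Snd | Oracle
| Pair (c d : functional)
| Comp (c d : functional)
| PrimRec (c d : functional)
| Mu (c : functional).

Definition charf (A : nat -> Prop) (n y : nat) : Prop :=
  (A n /\ y = 1) \/ (~ A n /\ y = 0).

(* [eval A c n y]: the computation of [c] with oracle [A] on input [n]
   converges to [y].  [PrimRec c d] maps <|m,0|> to [c m] and <|m,k+1|> to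
   [d <|m,<|k,z|>|>], where [z] is its value at <|m,k|>. *)
Fixpoint eval (A : nat -> Prop) (c : functional) (n y : nat) : Prop :=
  match c with
  | Zero => y = 0
  | Succ => y = S n
  | Fst => y = fst (Cantor.of_nat n)
  | Snd => y = snd (Cantor.of_nat n)
  | Oracle => charf A n y
  | Pair c d => exists u v, eval A c n u /\ eval A d n v /\ y = <|u, v|>
  | Comp c d => exists u, eval A d n u /\ eval A c u y
  | PrimRec c d =>
      let m := fst (Cantor.of_nat n) in
      nat_rect (fun _ => nat -> Prop)
        (eval A c m)
        (fun k value w => exists z, value z /\ eval A d <|m, <|k, z|>|> w)
        (snd (Cantor.of_nat n)) y
  | Mu c =>
      eval A c <|n, y|> 0 /\
      forall k, k < y -> exists v, eval A c <|n, k|> (S v)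
  end.

Definition turing_le (A B : nat -> Prop) : Prop :=
  exists c, forall n y, charf A n y -> eval B c n y.

Definition turing_equiv (A B : nat -> Prop) : Prop :=
  turing_le A B /\ turing_le B A.

Definition degree : Type := (nat -> Prop) -> Prop.

Definition deg (A : nat -> Prop) : degree := fun B => turing_equiv B A.

Definition join (A B : nat -> Prop) (n : nat) : Prop :=
  (exists k, n = 2 * k /\ A k) \/ (exists k, n = 2 * k + 1 /\ B k).

(* The isomorphism [proj] is uniquely determined on [carrier]; its values
   elsewhere are never used. *)
Record omega_copy := OmegaCopy {
  carrier : nat -> Prop;
  prec : nat -> nat -> Prop;
  proj : nat -> nat;
  prec_carrier : forall x y, prec x y -> carrier x /\ carrier y;
  proj_inj : forall x y, carrier x -> carrier y -> proj x = proj y -> x = y;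
  proj_surj : forall n, exists x, carrier x /\ proj x = n;
  proj_mono : forall x y, carrier x -> carrier y ->
    (prec x y <-> proj x < proj y)
}.

Definition graph_of_rel (r : nat -> nat -> Prop) (n : nat) : Prop :=
  exists x y, n = <|x, y|> /\ r x y.

Definition computable_copy (X : nat -> Prop) (L : omega_copy) : Prop :=
  turing_le (carrier L) X /\ turing_le (graph_of_rel (prec L)) X.

(* The graph of f^L = proj^-1 o f o proj : carrier -> carrier. *)
Definition transport (f : nat -> nat) (L : omega_copy) : nat -> Prop :=
  graph_of_rel (fun x y => carrier L x /\ carrier L y /\ proj L y = f (proj L x)).

Definition DgSp (X : nat -> Prop) (f : nat -> nat) (d : degree) : Prop :=
  exists L, computable_copy X L /\ d = deg (join (transport f L) X).

Definition intrinsically_computable_on_a_cone (f : nat -> nat) : Prop :=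
  exists X, forall Y, turing_le X Y -> forall d, DgSp Y f d <-> d = deg Y.

Definition closed_interval (f : nat -> nat) (a b : nat) : Prop :=
  (forall x, a <= x <= b -> a <= f x <= b) /\
  (forall x, a <= f x <= b -> a <= x <= b).

Definition block_function (f : nat -> nat) : Prop :=
  forall n, exists a b, a <= n <= b /\ closed_interval f a b.

(* Intervals that are closed for [f] and contain [n] are stable under
   intersection, so minimal means least. *)
Definition is_block_of (f : nat -> nat) (n a b : nat) : Prop :=
  a <= n <= b /\ closed_interval f a b /\
  forall c d, c <= n <= d -> closed_interval f c d -> c <= a /\ b <= d.

Definition is_block (f : nat -> nat) (a b : nat) : Prop :=
  exists n, is_block_of f n a b.

Definition block_embeds (f : nat -> nat) (a b c d : nat) : Prop :=
  exists h : nat -> nat,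
    (forall x, a <= x <= b -> c <= h x <= d) /\
    (forall x y, a <= x <= b -> a <= y <= b -> x < y -> h x < h y) /\
    (forall x, a <= x <= b -> h (f x) = f (h x)).

Definition eventually_blocks_embed_later (f : nat -> nat) : Prop :=
  exists N, forall a b, N <= a -> is_block f a b ->
    exists c d, is_block f c d /\ b < c /\ block_embeds f a b c d.

(* [eval3 G A e x s y] is Gamma^A(e, x, s) = y. *)
Definition eval3 (G : functional) (A : nat -> Prop) (e x s y : nat) : Prop :=
  eval A G <|e, <|x, s|>|> y.

(* [has_limit G A e x y] is lim_s Gamma^A(e, x, s) = y. *)
Definition has_limit (G : functional) (A : nat -> Prop) (e x y : nat) : Prop :=
  exists s0, forall s, s0 <= s -> eval3 G A e x s y.

(* The set X_e^A. *)
Definition limit_set (G : functional) (A : nat -> Prop) (e : nat) : nat -> Prop :=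
  fun x => has_limit G A e x 1.

(* Main.v *)
(* Only finitely many bits of A matter at each stage of a construction, so an
   arbitrary function of this finite information may be used as long as its
   table is part of Z. It remains to diagonalise against X_e = Phi^(f^L + A),
   f^L = Psi^(X_e) by finite injury. A function that is eventually the identity
   is intrinsically computable, so f moves arbitrarily large points. Wait until
   the current approximation sigma to X_e below some u is computed by Phi, and
   Psi computes from sigma that f^L x = y for some x <> y of low priority.
   While X_e looks like sigma, shift everything above the higher priority part
   of L so that f^L x <> y; once X_e looks different, insert elements so that
   every block is mapped into a later block containing a copy of it, which
   restores the old values of f^L and hence the computation of sigma by Phi.
   Each such round changes X_e below u, so there are finitely many of them, and
   the final outcome refutes Psi or Phi, respectively. *)
From Stdlib Require Import Arith Cantor Lia List Permutation Classical ClassicalEpsilon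
  FunctionalExtensionality PropExtensionality.
Require Import Defs.
Import ListNotations.

#[local] Opaque to_nat of_nat.

(** * Oracle computability *)

Lemma charf_fun A n y y' : charf A n y -> charf A n y' -> y = y'.
Proof. unfold charf; intuition congruence. Qed.

Lemma eval_fun c : forall A n y y', eval A c n y -> eval A c n y' -> y = y'.
Proof.
  induction c; intros A n y y' H H'; simpl in *; try congruence.
  - eauto using charf_fun.
  - destruct H as (u & v & Hu & Hv & ->), H' as (u' & v' & Hu' & Hv' & ->).
    rewrite (IHc1 _ _ _ _ Hu Hu'), (IHc2 _ _ _ _ Hv Hv'); reflexivity.
  - destruct H as (u & Hu & Hv), H' as (u' & Hu' & Hv').
    rewrite (IHc2 _ _ _ _ Hu' Hu) in Hv'; eauto.
  - revert y y' H H'.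
    induction (snd (of_nat n)) as [|k IH]; simpl; intros y y' H H'; [eauto|].
    destruct H as (z & Hz & H), H' as (z' & Hz' & H').
    rewrite (IH _ _ Hz' Hz) in H'; eauto.
  - destruct H as (H & Hlt), H' as (H' & Hlt').
    destruct (Nat.lt_trichotomy y y') as [Hy|[Hy|Hy]]; [|exact Hy|].
    + destruct (Hlt' _ Hy) as (v & Hv). now specialize (IHc _ _ _ _ H Hv).
    + destruct (Hlt _ Hy) as (v & Hv). now specialize (IHc _ _ _ _ H' Hv).
Qed.

Definition agree (v : nat) (A B : nat -> Prop) : Prop :=
  forall n, n < v -> (A n <-> B n).

Lemma agree_le v w A B : v <= w -> agree w A B -> agree v A B.
Proof. intros H HA n Hn; apply HA; lia. Qed.

Lemma agree_sym v A B : agree v A B -> agree v B A.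
Proof. intros H n Hn; symmetry; auto. Qed.

Lemma agree_trans v A B C : agree v A B -> agree v B C -> agree v A C.
Proof. intros H H' n Hn; rewrite (H n Hn); auto. Qed.

Lemma bounded_choice (P : nat -> nat -> Prop) n :
  (forall k v w, v <= w -> P k v -> P k w) ->
  (forall k, k < n -> exists v, P k v) ->
  exists v, forall k, k < n -> P k v.
Proof.
  intros Hmon. induction n as [|n IH]; intros H.
  - exists 0; lia.
  - destruct IH as (v & Hv); [intros; apply H; lia|].
    destruct (H n) as (w & Hw); [lia|].
    exists (v + w). intros k Hk.
    destruct (Nat.eq_dec k n) as [->|].
    + apply Hmon with w; auto; lia.
    + apply Hmon with v; [lia|apply Hv; lia].
Qed.

(** The use principle. For [Mu], the uses of the finitely many tests before the least zero are
    combined by [bounded_choice]. *)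
Lemma eval_use c : forall A n y, eval A c n y ->
  exists v, forall B, agree v A B -> eval B c n y.
Proof.
  induction c; intros A n y H; simpl in *; try (exists 0; intros; assumption).
  - exists (S n). intros B HB. assert (HA : A n <-> B n) by (apply HB; lia).
    unfold charf in *; tauto.
  - destruct H as (u & v & Hu & Hv & ->).
    destruct (IHc1 _ _ _ Hu) as (v1 & H1), (IHc2 _ _ _ Hv) as (v2 & H2).
    exists (v1 + v2). intros B HB. exists u, v.
    split; [|split]; eauto using agree_le, Nat.le_add_r, Nat.le_add_l.
  - destruct H as (u & Hu & Hv).
    destruct (IHc2 _ _ _ Hu) as (v1 & H1), (IHc1 _ _ _ Hv) as (v2 & H2).
    exists (v1 + v2). intros B HB. exists u.
    split; eauto using agree_le, Nat.le_add_r, Nat.le_add_l.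
  - revert y H.
    induction (snd (of_nat n)) as [|k IH]; simpl; intros y H; [eauto|].
    destruct H as (z & Hz & H).
    destruct (IH _ Hz) as (v1 & H1), (IHc2 _ _ _ H) as (v2 & H2).
    exists (v1 + v2). intros B HB. exists z.
    split; eauto using agree_le, Nat.le_add_r, Nat.le_add_l.
  - destruct H as (H & Hlt).
    destruct (IHc _ _ _ H) as (v1 & H1).
    destruct (bounded_choice (fun k v => exists u, forall B, agree v A B ->
      eval B c (to_nat (n, k)) (S u)) y) as (v2 & H2).
    + intros k v w Hvw (u & Hu); exists u; eauto using agree_le.
    + intros k Hk. destruct (Hlt k Hk) as (u & Hu).
      destruct (IHc _ _ _ Hu) as (v & Hv). eauto.
    + exists (v1 + v2). intros B HB. split.
      * eauto using agree_le, Nat.le_add_r.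
      * intros k Hk. destruct (H2 k Hk) as (u & Hu). exists u.
        eauto using agree_le, Nat.le_add_l.
Qed.

Fixpoint subst_oracle (d c : functional) : functional :=
  match c with
  | Oracle => d
  | Pair c1 c2 => Pair (subst_oracle d c1) (subst_oracle d c2)
  | Comp c1 c2 => Comp (subst_oracle d c1) (subst_oracle d c2)
  | PrimRec c1 c2 => PrimRec (subst_oracle d c1) (subst_oracle d c2)
  | Mu c1 => Mu (subst_oracle d c1)
  | _ => c
  end.

Lemma eval_subst_oracle A B d (Hd : forall n y, charf A n y -> eval B d n y) c :
  forall n y, eval A c n y -> eval B (subst_oracle d c) n y.
Proof.
  induction c; intros n y H; simpl in *; auto.
  - destruct H as (u & v & Hu & Hv & ->). exists u, v. auto.
  - destruct H as (u & Hu & Hv). exists u. auto.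
  - revert y H.
    induction (snd (of_nat n)) as [|k IH]; simpl; intros y H; [eauto|].
    destruct H as (z & Hz & H). exists z. auto.
  - destruct H as (H & Hlt). split; [auto|].
    intros k Hk. destruct (Hlt k Hk) as (v & Hv). eauto.
Qed.

Lemma turing_le_refl A : turing_le A A.
Proof. exists Oracle. simpl. auto. Qed.

Lemma turing_le_trans A B C : turing_le A B -> turing_le B C -> turing_le A C.
Proof.
  intros (c & Hc) (d & Hd). exists (subst_oracle d c).
  intros n y H. eapply eval_subst_oracle; eauto.
Qed.

Lemma deg_eq A B : turing_equiv A B -> deg A = deg B.
Proof.
  intros [H1 H2]. apply functional_extensionality; intros C.
  apply propositional_extensionality; unfold deg, turing_equiv.
  split; intros [H3 H4]; split; eauto using turing_le_trans.
Qed.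

Lemma deg_inj A B : deg A = deg B -> turing_equiv A B.
Proof.
  intros H. change (deg B A). rewrite <- H. split; apply turing_le_refl.
Qed.

(** * Computable functions and tables of continuous operators *)

Definition comp (A : nat -> Prop) (g : nat -> nat) : Prop :=
  exists c, forall n, eval A c n (g n).

Definition chi (A : nat -> Prop) (n : nat) : nat :=
  if excluded_middle_informative (A n) then 1 else 0.

Lemma chi_iff A n : chi A n = 1 <-> A n.
Proof. unfold chi; destruct excluded_middle_informative; intuition congruence. Qed.

Lemma charf_chi A n : charf A n (chi A n).
Proof. unfold chi, charf; destruct excluded_middle_informative; auto. Qed.

Lemma turing_le_comp A B : turing_le A B <-> comp B (chi A).
Proof.
  split; intros (c & Hc); exists c.
  - intros n. apply Hc, charf_chi.
  - intros n y H. rewrite (charf_fun _ _ _ _ H (charf_chi A n)). apply Hc.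
Qed.

Lemma comp_const A k : comp A (fun _ => k).
Proof.
  induction k as [|k (c & Hc)].
  - exists Zero; simpl; auto.
  - exists (Comp Succ c); simpl; eauto.
Qed.

Lemma comp_id A : comp A (fun n => n).
Proof.
  exists (Pair Fst Snd). intros n. simpl. do 2 eexists.
  do 2 (split; [reflexivity|]).
  symmetry. etransitivity; [|apply cancel_to_of].
  now destruct (of_nat n).
Qed.

Lemma comp_compose A g h : comp A g -> comp A h -> comp A (fun n => g (h n)).
Proof. intros (c & Hc) (d & Hd). exists (Comp c d). simpl; eauto. Qed.

Lemma comp_pair A g h :
  comp A g -> comp A h -> comp A (fun n => to_nat (g n, h n)).
Proof. intros (c & Hc) (d & Hd). exists (Pair c d). simpl. intros n. exists (g n), (h n). auto. Qed.

Lemma comp_fst A : comp A (fun n => fst (of_nat n)).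
Proof. exists Fst; simpl; auto. Qed.

(* The oracle is the complement of the graph because [Mu] looks for a zero. *)
Definition table (g : nat -> nat) : nat -> Prop :=
  graph_of_rel (fun n y => y <> g n).

Lemma comp_table A g : turing_le (table g) A -> comp A g.
Proof.
  intros (c & Hc). exists (Mu c). intros n. simpl. split.
  - apply Hc. right. split; [|reflexivity].
    intros (x & y & E & H). apply to_nat_inj in E. congruence.
  - intros k Hk. exists 0. apply Hc. left. split; [|reflexivity].
    exists n, k. split; auto; lia.
Qed.

(** A single table can hold countably many functions, so one oracle lies above all of them at
    once. *)
Lemma comp_tables (G : nat -> nat -> nat) A :
  turing_le (table (fun n => G (fst (of_nat n)) (snd (of_nat n)))) A ->
  forall j, comp A (G j).
Proof.
  intros H j. apply comp_table in H.
  assert (H1 := comp_compose _ _ _ H (comp_pair _ _ _ (comp_const A j) (comp_id A))).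
  destruct H1 as (c & Hc). exists c. intros n. specialize (Hc n).
  cbv beta in Hc. rewrite cancel_of_to in Hc. exact Hc.
Qed.

(** A number coding the finite sequence of the first [m] values of [I]; for fixed [m] it determines
    them. *)
Fixpoint hist (I : nat -> nat) (m : nat) : nat :=
  match m with
  | 0 => 0
  | S m => to_nat (hist I m, I m)
  end.

Lemma hist_inj I J m : hist I m = hist J m -> forall k, k < m -> I k = J k.
Proof.
  induction m as [|m IH]; cbn [hist]; intros H k Hk; [lia|].
  apply to_nat_inj in H. injection H as H1 H2.
  destruct (Nat.eq_dec k m) as [->|]; auto. apply IH; auto; lia.
Qed.

Lemma comp_hist A I : comp A I -> comp A (hist I).
Proof.
  intros (c & Hc).
  (* In the recursion step, [Comp Snd Snd] reads the previous value and [Comp Fst Snd] the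
     counter. *)
  set (p := PrimRec Zero (Pair (Comp Snd Snd) (Comp c (Comp Fst Snd)))).
  assert (H : forall m k, eval A p (to_nat (m, k)) (hist I k)).
  { intros m k. unfold p. cbn [eval]. rewrite cancel_of_to. cbn [fst snd].
    induction k as [|k IH]; cbn [nat_rect hist]; [reflexivity|].
    exists (hist I k). split; [exact IH|].
    cbn [eval]. exists (hist I k), (I k). split; [|split; [|reflexivity]].
    - exists (to_nat (k, hist I k)). rewrite !cancel_of_to. auto.
    - exists k. split; [|apply Hc].
      exists (to_nat (k, hist I k)). rewrite !cancel_of_to. auto. }
  destruct (comp_pair A _ _ (comp_const A 0) (comp_id A)) as (d & Hd).
  exists (Comp p d). intros n. cbn [eval]. eauto.
Qed.

(* The table of a continuous operator is a single set, so above its degree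
   continuity alone yields relative computability. *)
Lemma continuous_computable (F : (nat -> nat) -> nat -> nat) :
  (forall n, exists m, forall I J,
    (forall k, k < m -> I k = J k) -> F I n = F J n) ->
  exists Z, forall A, turing_le Z A -> forall I, comp A I -> comp A (F I).
Proof.
  intros HF.
  assert (Hg : exists g : nat -> nat, forall n I J,
    (forall k, k < g n -> I k = J k) -> F I n = F J n).
  { exists (fun n => proj1_sig (constructive_indefinite_description _ (HF n))).
    intros n. exact (proj2_sig (constructive_indefinite_description _ (HF n))). }
  destruct Hg as (g & Hg).
  (* [dec] picks any function with the given history, and [P] applies [F] to it. Since [g] is a
     modulus of continuity of [F], a history of length [g n] suffices for the true value at [n]. *)
  set (dec := fun m h => epsilon (inhabits (fun _ : nat => 0))
    (fun I => hist I m = h)).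
  set (P := fun q => let n := snd (of_nat q) in
    F (dec (g n) (fst (of_nat q))) n).
  set (G := fun j => match j with 0 => g | _ => P end).
  exists (table (fun n => G (fst (of_nat n)) (snd (of_nat n)))).
  intros A HA I HI.
  pose proof (comp_tables G A HA 0 : comp A g) as Cg.
  pose proof (comp_tables G A HA 1 : comp A P) as CP.
  pose proof (comp_compose _ _ _ CP (comp_pair _ _ _
    (comp_compose _ _ _ (comp_hist A I HI) Cg) (comp_id A))) as (c & Hc).
  exists c. intros n. specialize (Hc n).
  replace (F I n) with (P (to_nat (hist I (g n), n))); [exact Hc|].
  unfold P. rewrite cancel_of_to. cbn [fst snd].
  apply Hg. apply hist_inj. unfold dec.
  apply (epsilon_spec (inhabits (fun _ : nat => 0))
    (fun J => hist J (g n) = hist I (g n))). eauto.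
Qed.

Fixpoint functional_code (c : functional) : nat :=
  match c with
  | Zero => to_nat (0, 0)
  | Succ => to_nat (0, 1)
  | Fst => to_nat (0, 2)
  | Snd => to_nat (0, 3)
  | Oracle => to_nat (0, 4)
  | Pair c d => to_nat (1, to_nat (functional_code c, functional_code d))
  | Comp c d => to_nat (2, to_nat (functional_code c, functional_code d))
  | PrimRec c d => to_nat (3, to_nat (functional_code c, functional_code d))
  | Mu c => to_nat (4, functional_code c)
  end.

Lemma functional_code_inj c : forall d,
  functional_code c = functional_code d -> c = d.
Proof.
  induction c; intros [] H; cbn [functional_code] in H; apply to_nat_inj in H;
    try discriminate; try reflexivity; injection H as H;
    try (apply to_nat_inj in H; injection H as H H'); f_equal; auto.
Qed.

(** A left inverse of the coding, so that numbers can index all pairs of reductions. *)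
Definition functional_of (n : nat) : functional :=
  epsilon (inhabits Zero) (fun c => functional_code c = n).

Lemma functional_of_code c : functional_of (functional_code c) = c.
Proof.
  apply functional_code_inj. unfold functional_of.
  apply (epsilon_spec (inhabits Zero)
    (fun d => functional_code d = functional_code c)). eauto.
Qed.

(** * Functions that are eventually the identity *)

Lemma join_l A B n : join A B (2 * n) <-> A n.
Proof.
  unfold join. split; [|left; eauto].
  intros [(k & E & H)|(k & E & H)]; [|lia].
  replace n with k by lia; auto.
Qed.

Lemma join_r A B n : join A B (2 * n + 1) <-> B n.
Proof.
  unfold join. split; [|right; eauto].
  intros [(k & E & H)|(k & E & H)]; [lia|].
  replace n with k by lia; auto.
Qed.

Lemma turing_le_join_r A B : turing_le B (join A B).
Proof.
  apply turing_le_comp.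
  set (p := PrimRec (Comp Succ Zero) (Comp (Comp Succ Succ) (Comp Snd Snd))).
  assert (H : forall m k, eval (join A B) p (to_nat (m, k)) (2 * k + 1)).
  { intros m k. unfold p. cbn [eval]. rewrite cancel_of_to. cbn [fst snd].
    induction k as [|k IH]; cbn [nat_rect].
    - exists 0. split; reflexivity.
    - exists (2 * k + 1). split; [exact IH|]. cbn [eval].
      exists (2 * k + 1). split.
      + exists (to_nat (k, 2 * k + 1)). rewrite !cancel_of_to. auto.
      + exists (S (2 * k + 1)). split; [reflexivity|lia]. }
  destruct (comp_pair (join A B) _ _ (comp_const _ 0) (comp_id _)) as (d & Hd).
  exists (Comp Oracle (Comp p d)). intros n. exists (2 * n + 1). split.
  - exists (to_nat (0, n)). split; auto.
  - change (charf (join A B) (2 * n + 1) (chi B n)). unfold charf.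
    rewrite join_r. apply charf_chi.
Qed.

Definition id_copy : omega_copy.
Proof.
  refine (OmegaCopy (fun _ => True) lt (fun n => n) _ _ _ _); auto.
  - intros n; eauto.
  - intros; reflexivity.
Defined.

(** The case distinction of a join as a function on codes; like [Nat.div2] it is later read off a
    table instead of being programmed. *)
Definition join_select (q : nat) : nat :=
  if Nat.even (fst (of_nat q)) then fst (of_nat (snd (of_nat q)))
  else snd (of_nat (snd (of_nat q))).

Lemma chi_ext A B n m :
  (A n <-> B m) -> chi A n = chi B m.
Proof.
  intros H; unfold chi; do 2 destruct excluded_middle_informative; tauto.
Qed.

Lemma join_le A B C : comp C Nat.div2 -> comp C join_select ->
  turing_le A C -> turing_le B C -> turing_le (join A B) C.
Proof.
  rewrite !turing_le_comp. intros Hd Hj HA HB.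
  pose proof (comp_compose _ _ _ Hj (comp_pair _ _ _ (comp_id C)
    (comp_pair _ _ _ (comp_compose _ _ _ HA Hd) (comp_compose _ _ _ HB Hd))))
    as (c & Hc).
  exists c. intros n. specialize (Hc n). cbv beta in Hc.
  replace (chi (join A B) n) with
    (join_select (to_nat (n, to_nat (chi A (Nat.div2 n), chi B (Nat.div2 n)))));
    [exact Hc|].
  unfold join_select. rewrite cancel_of_to. cbn [fst snd].
  rewrite cancel_of_to. cbn [fst snd].
  destruct (Nat.even n) eqn:E.
  - apply Nat.even_spec in E as [k ->]. rewrite Nat.div2_double.
    apply chi_ext. now rewrite join_l.
  - assert (O : Nat.odd n = true) by (rewrite <- Nat.negb_even, E; auto).
    apply Nat.odd_spec in O as [k ->].
    replace (Nat.div2 (2 * k + 1)) with k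
      by (rewrite Nat.add_1_r, Nat.div2_succ_double; auto).
    apply chi_ext. now rewrite join_r.
Qed.

Section EventuallyIdentity.
Context (f : nat -> nat) (m : nat) (Hm : forall p, m <= p -> f p = p).

(* [hist h m] lists the finite part of the graph of [f] on a copy, [b] tells
   whether the first component of [n] belongs to the copy. *)
Definition patched_diagonal (e n b : nat) : Prop :=
  exists h, hist h m = e /\
    ((exists p, p < m /\ h p = n) \/
     ((forall p, p < m -> fst (of_nat (h p)) <> fst (of_nat n)) /\
      b = 1 /\ fst (of_nat n) = snd (of_nat n))).

(** From position [m] on, f^L is the identity, so its graph is the diagonal of the carrier changed
    at [m] arguments only; [e] codes these finitely many points of the graph. *)
Lemma transport_patched L : exists e, forall n,
  transport f L n <-> patched_diagonal e n (chi (carrier L) (fst (of_nat n))).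
Proof.
  set (inv := fun n => proj1_sig (constructive_indefinite_description _
    (proj_surj L n))).
  assert (Hinv : forall n, carrier L (inv n) /\ proj L (inv n) = n).
  { intros n. apply (proj2_sig (constructive_indefinite_description _
      (proj_surj L n))). }
  set (h := fun p => to_nat (inv p, inv (f p))).
  exists (hist h m). intros n. split.
  - intros (x & y & -> & Hx & Hy & E).
    exists h. split; [reflexivity|]. rewrite cancel_of_to. cbn [fst snd].
    destruct (Nat.lt_ge_cases (proj L x) m) as [Hlt|Hge].
    + left. exists (proj L x). split; [auto|]. unfold h.
      apply (f_equal to_nat), f_equal2; apply (proj_inj L); auto; try apply Hinv.
      rewrite E. apply Hinv.
    + right. split; [|split].
      * intros p Hp E'. unfold h in E'. rewrite cancel_of_to in E'.
        cbn in E'. subst x. destruct (Hinv p) as [_ E']. lia.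
      * now apply chi_iff.
      * rewrite (Hm _ Hge) in E. symmetry. apply (proj_inj L); auto.
  - intros (h' & Eh & H). assert (Eh' := hist_inj _ _ _ Eh).
    destruct H as [(p & Hp & <-)|(Hn & Hb & E)].
    + rewrite (Eh' p Hp). exists (inv p), (inv (f p)).
      split; [reflexivity|]. destruct (Hinv p) as [H1 H2], (Hinv (f p)) as [H3 H4].
      split; [|split]; auto. congruence.
    + rewrite chi_iff in Hb. exists (fst (of_nat n)), (fst (of_nat n)).
      split; [|split; [|split]]; auto.
      * rewrite E at 2. rewrite <- (cancel_to_of n) at 1. now destruct (of_nat n).
      * symmetry. apply Hm.
        destruct (Nat.lt_ge_cases (proj L (fst (of_nat n))) m) as [Hlt|]; auto.
        exfalso. apply (Hn _ Hlt). rewrite (Eh' _ Hlt). unfold h.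
        rewrite cancel_of_to. cbn [fst].
        apply (proj_inj L); auto; apply Hinv.
Qed.

(** By [transport_patched], f^L is computable from the carrier and a number [e]. The table [G 3]
    takes [e] as an argument, so one oracle serves all copies. The standard copy shows that the
    degree of [Y] is realised. *)
Lemma eventually_id_intrinsically_computable :
  intrinsically_computable_on_a_cone f.
Proof.
  set (G := fun j => match j with
    | 0 => Nat.div2
    | 1 => join_select
    | 2 => chi (graph_of_rel lt)
    | _ => chi (fun q => patched_diagonal (fst (of_nat q))
        (fst (of_nat (snd (of_nat q)))) (snd (of_nat (snd (of_nat q)))))
    end).
  exists (table (fun n => G (fst (of_nat n)) (snd (of_nat n)))).
  intros Y HY. assert (C := comp_tables G Y HY).
  assert (HD : forall L, computable_copy Y L ->
    deg (join (transport f L) Y) = deg Y).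
  { intros L [HL _]. apply deg_eq. split; [|apply turing_le_join_r].
    apply join_le; [apply (C 0)|apply (C 1)| |apply turing_le_refl].
    apply turing_le_comp. apply turing_le_comp in HL.
    destruct (transport_patched L) as (e & He).
    pose proof (comp_compose _ _ _ (C 3) (comp_pair _ _ _ (comp_const Y e)
      (comp_pair _ _ _ (comp_id Y) (comp_compose _ _ _ HL (comp_fst Y)))))
      as (c & Hc).
    exists c. intros n. specialize (Hc n). cbv beta in Hc.
    replace (chi (transport f L) n) with
      (G 3 (to_nat (e, to_nat (n, chi (carrier L) (fst (of_nat n))))));
      [exact Hc|].
    apply chi_ext.
    rewrite cancel_of_to. cbn [fst snd]. rewrite cancel_of_to. cbn [fst snd].
    symmetry. apply He. }
  intros d. split.
  - intros (L & HL & ->). auto.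
  - intros ->. exists id_copy.
    assert (HL : computable_copy Y id_copy).
    { split; apply turing_le_comp; [|exact (C 2)].
      destruct (comp_const Y 1) as (c & Hc). exists c. intros n.
      replace (chi _ n) with 1; [apply Hc|]. symmetry. now apply chi_iff. }
    split; [exact HL|]. symmetry. auto.
Qed.
End EventuallyIdentity.

(** * Block functions *)

Definition incr_on (g : nat -> nat) (a b : nat) : Prop :=
  forall p q, a <= p -> p < q -> q < b -> g p < g q.

Lemma incr_on_ge g n : incr_on g 0 n -> forall p, p < n -> p <= g p.
Proof.
  intros Hg p. induction p as [|p IH]; intros Hp; [lia|].
  specialize (Hg p (S p)). lia.
Qed.

Lemma incr_on_inj g n p q :
  incr_on g 0 n -> p < n -> q < n -> g p = g q -> p = q.
Proof.
  intros Hg Hp Hq E. destruct (Nat.lt_trichotomy p q) as [H|[H|H]]; auto;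
    [specialize (Hg p q)|specialize (Hg q p)]; lia.
Qed.

Lemma bounded_on (g : nat -> nat) n : exists B, forall p, p < n -> g p < B.
Proof.
  destruct (bounded_choice (fun p B => g p < B) n) as (B & HB); eauto.
  intros; lia.
Qed.

Lemma last_below (P : nat -> Prop) r k : P r -> r < k ->
  exists p, r <= p < k /\ P p /\ forall z, p < z < k -> ~ P z.
Proof.
  intros Hr. induction k as [|k IH]; intros Hk; [lia|].
  destruct (classic (P k)) as [H|H].
  - exists k. split; [lia|]. split; [auto|lia].
  - assert (r <> k) by congruence.
    destruct IH as (p & Hp & HP & Hz); [lia|].
    exists p. split; [lia|]. split; [auto|].
    intros z Hz'. destruct (Nat.eq_dec z k) as [->|]; auto. apply Hz; lia.
Qed.

Section Blocks.
Context (f : nat -> nat) (f_block : block_function f).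

(** Cuts are the boundaries between blocks: [f] maps neither side into the other. *)
Definition cut (n : nat) : Prop := forall x, x < n <-> f x < n.

(** If [a,b] is a closed interval around a cut m, then its union with [0,m) is [0,b], so b+1 is a
    larger cut. *)
Lemma cuts_unbounded n : exists m, n < m /\ cut m.
Proof.
  assert (Hnext : forall m, cut m -> exists m', m < m' /\ cut m').
  { intros m Hm. destruct (f_block m) as (a & b & Hab & H1 & H2).
    exists (S b). split; [lia|]. intros x.
    specialize (Hm x). specialize (H1 x). specialize (H2 x). lia. }
  induction n as [|n (m & Hm & Hc)].
  - apply Hnext. intros x; lia.
  - destruct (Hnext m Hc) as (m' & Hm' & Hc'). exists m'. split; [lia|auto].
Qed.

(** A closed interval around [p] ending at some [d < q - 1] would make [d + 1] a cut strictly
    between [p] and [q]. *)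
Lemma consecutive_cuts_block p q : cut p -> cut q -> p < q ->
  (forall z, p < z < q -> ~ cut z) -> is_block f p (q - 1).
Proof.
  intros Hp Hq Hpq Hz. exists p. split; [lia|]. split.
  - split; intros x; specialize (Hp x); specialize (Hq x); lia.
  - intros c d Hcd [H1 H2]. split; [lia|].
    destruct (Nat.lt_ge_cases d (q - 1)) as [Hd|]; [|auto].
    exfalso. apply (Hz (S d)); [lia|]. intros x.
    specialize (Hp x). specialize (H1 x). specialize (H2 x). lia.
Qed.

(** Otherwise [f] would be a translation from [a] on and carry a point across some cut, upwards if
    [a < b] and downwards if [b < a]. *)
Lemma shift_breaks a b : a <> b -> exists t, f (a + t) <> b + t.
Proof.
  intros Hab. apply NNPP. intros Hn.
  assert (H : forall t, f (a + t) = b + t).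
  { intros t. apply NNPP. eauto. }
  destruct (cuts_unbounded (a + b)) as (m & Hm & Hc).
  destruct (Nat.lt_ge_cases a b) as [Hlt|Hge].
  - specialize (Hc (a + (m - 1 - a))). rewrite H in Hc. lia.
  - specialize (Hc (a + (m - 1 - b))). rewrite H in Hc. lia.
Qed.

Context (N : nat) (HN : forall a b, N <= a -> is_block f a b ->
  exists c d, is_block f c d /\ b < c /\ block_embeds f a b c d).

(** Embeddings compose, and each use of [HN] moves the target block at least one position to the
    right. *)
Lemma block_embeds_far M a b : N <= a -> is_block f a b ->
  exists c d, M <= c /\ N <= c /\ is_block f c d /\ block_embeds f a b c d.
Proof.
  intros Ha Hb. induction M as [|M (c & d & Hc & Hc' & Hcd & h & H1 & H2 & H3)].
  - destruct (HN a b Ha Hb) as (c & d & Hcd & Hbc & H).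
    exists c, d. split; [lia|]. split; auto.
    destruct Hb as (n & Hn & _). lia.
  - destruct (HN c d Hc' Hcd) as (c' & d' & Hcd' & Hdc & k & K1 & K2 & K3).
    exists c', d'. destruct Hcd as (n & Hn & _).
    split; [lia|]. split; [lia|]. split; auto.
    exists (fun x => k (h x)). split; [|split]; auto.
    intros x Hx. rewrite H3, K3; auto.
Qed.

(** The blocks between [r] and [p] are embedded one after the other, each beyond the images of all
    earlier ones. *)
Lemma embed_far r M : cut r -> N <= r -> forall p, cut p -> r <= p ->
  exists H, incr_on H r p /\ (forall x, r <= x < p -> M <= H x) /\
    (forall x, r <= x < p -> H (f x) = f (H x)).
Proof.
  intros Hr HNr p. induction p as [p IH] using lt_wf_ind. intros Hp Hrp.
  destruct (Nat.eq_dec r p) as [<-|Hne].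
  - exists (fun x => x). split; [|split]; try (intros; lia).
    intros ? ? ? ? ?; lia.
  - destruct (last_below cut r p Hr) as (p' & Hp' & Hc & Hz); [lia|].
    destruct (IH p') as (H & H1 & H2 & H3); [lia|auto|lia|].
    destruct (bounded_on H p') as (B & HB).
    destruct (block_embeds_far (B + M) p' (p - 1)) as
      (c & d & Hcd & _ & _ & h & E1 & E2 & E3).
    { lia. }
    { apply consecutive_cuts_block; auto; lia. }
    exists (fun x => if x <? p' then H x else h x). split; [|split].
    + intros x y Hx Hxy Hy.
      destruct (Nat.ltb_spec x p'), (Nat.ltb_spec y p'); try lia.
      * apply H1; lia.
      * specialize (HB x). specialize (E1 y). lia.
      * apply E2; lia.
    + intros x Hx. destruct (Nat.ltb_spec x p'); [apply H2; lia|].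
      specialize (E1 x). lia.
    + intros x Hx. assert (Hx' := Hc x).
      destruct (Nat.ltb_spec x p'), (Nat.ltb_spec (f x) p'); try lia.
      * apply H3; lia.
      * apply E3; lia.
Qed.

(** * Finite stages of a copy *)

Definition placed (g : nat -> nat) (c w : list nat) : Prop :=
  forall p x, nth_error c p = Some x -> nth_error w (g p) = Some x.

Definition prefix (b w : list nat) : Prop := placed (fun p => p) b w.

Lemma nth_error_lt {A} (w : list A) p x : nth_error w p = Some x -> p < length w.
Proof. intros H. apply nth_error_Some. congruence. Qed.

Lemma nth_error_ex {A} (w : list A) p : p < length w ->
  exists x, nth_error w p = Some x.
Proof.
  intros H. apply nth_error_Some in H.
  destruct (nth_error w p); [eauto|congruence].
Qed.

Lemma prefix_length b w : prefix b w -> length b <= length w.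
Proof.
  intros H. destruct (Nat.le_gt_cases (length b) (length w)) as [|Hlt]; auto.
  destruct (nth_error_ex _ _ Hlt) as (x & Hx).
  apply H in Hx. apply nth_error_lt in Hx. lia.
Qed.

Lemma prefix_refl w : prefix w w.
Proof. intros p x; auto. Qed.

Lemma prefix_trans u v w : prefix u v -> prefix v w -> prefix u w.
Proof. intros H H' p x Hp. apply H', H, Hp. Qed.

(** The elements of [F] fill the positions not taken by [g]. When the last element of the list is
    peeled off, its target [q] dictates that exactly [k] fillers are spent before it. *)
Lemma merge w : forall F g, incr_on g 0 (length w) ->
  (forall p, p < length w -> g p < length w + length F) ->
  exists w', Permutation w' (w ++ F) /\ placed g w w'.
Proof.
  induction w as [|x w IH] using rev_ind; intros F g Hg HF.
  - exists F. split; [apply Permutation_refl|]. intros [|p] y H; discriminate.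
  - rewrite length_app in Hg, HF. cbn [length] in Hg, HF.
    assert (Hq := HF (length w) ltac:(lia)).
    assert (Hle := incr_on_ge _ _ Hg (length w) ltac:(lia)).
    set (q := g (length w)) in *. set (k := q - length w).
    assert (Hlt : forall p, p < length w -> g p < q)
      by (intros p Hp; apply Hg; lia).
    assert (Hk : length (firstn k F) = k) by (rewrite length_firstn; lia).
    destruct (IH (firstn k F) g) as (w' & Hw' & Hp).
    { intros p p' H1 H2 H3. apply Hg; lia. }
    { intros p Hp. rewrite Hk. specialize (Hlt p Hp). lia. }
    assert (Hl : length w' = q).
    { rewrite (Permutation_length Hw'), length_app. lia. }
    exists (w' ++ x :: skipn k F). split.
    + rewrite Hw', <- !app_assoc. apply Permutation_app_head. cbn [app].
      symmetry. rewrite <- (firstn_skipn k F) at 1. apply Permutation_middle.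
    + intros p y Hy. destruct (Nat.lt_ge_cases p (length w)) as [Hpw|Hpw].
      * rewrite nth_error_app1 in Hy by auto.
        rewrite nth_error_app1 by (specialize (Hlt p Hpw); lia). auto.
      * assert (p = length w) as ->.
        { apply nth_error_lt in Hy. rewrite length_app in Hy.
          cbn [length] in Hy. lia. }
        rewrite nth_error_app2, Nat.sub_diag in Hy by lia.
        rewrite nth_error_app2 by lia. fold q. rewrite Hl, Nat.sub_diag. auto.
Qed.

(* [w] lists the elements of the copy in order. Its length is a cut so that
   appending elements to [w] does not change f^L on the elements of [w]. *)
Definition stage (w : list nat) : Prop :=
  NoDup w /\ (forall x, In x w <-> x < length w) /\ cut (length w).

Lemma nth_error_inj (w : list nat) p q x : NoDup w ->
  nth_error w p = Some x -> nth_error w q = Some x -> p = q.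
Proof.
  intros H Hp Hq. rewrite NoDup_nth_error in H.
  apply H; [eauto using nth_error_lt|congruence].
Qed.

(** The fillers are the numbers from [length w] up to [m - 1], so the elements again form an initial
    segment of the natural numbers. *)
Lemma spread w m g : stage w -> incr_on g 0 (length w) -> cut m ->
  length w <= m -> (forall p, p < length w -> g p < m) ->
  exists w', stage w' /\ length w' = m /\ placed g w w'.
Proof.
  intros (Hnd & Hin & _) Hg Hm Hle Hgm.
  destruct (merge w (seq (length w) (m - length w)) g) as (w' & Hp & Hw').
  - auto.
  - intros p Hp. rewrite length_seq. specialize (Hgm p Hp). lia.
  - assert (Hl : length w' = m).
    { rewrite (Permutation_length Hp), length_app, length_seq. lia. }
    exists w'. split; [|auto]. split; [|split].
    + apply (Permutation_NoDup (Permutation_sym Hp)), NoDup_app; auto.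
      * apply seq_NoDup.
      * intros x Hx. rewrite in_seq. apply Hin in Hx. lia.
    + intros x. rewrite Hl, Hp, in_app_iff, in_seq, Hin. lia.
    + rewrite Hl. auto.
Qed.

Definition graph_on (w : list nat) (a b : nat) : Prop :=
  exists p, nth_error w p = Some a /\ nth_error w (f p) = Some b.

(** Elements determine their positions, so both sides become equations between positions, which an
    injective map commuting with [f] preserves and reflects. *)
Lemma graph_on_placed g c w : stage c -> NoDup w -> placed g c w ->
  (forall p q, p < length c -> q < length c -> g p = g q -> p = q) ->
  (forall p, p < length c -> g (f p) = f (g p)) ->
  forall a b, a < length c -> b < length c ->
    (graph_on w a b <-> graph_on c a b).
Proof.
  intros (_ & Hin & Hcut) Hnd Hg Hinj Hcom a b Ha Hb.
  apply Hin, In_nth_error in Ha as [p Hp].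
  apply Hin, In_nth_error in Hb as [q Hq].
  assert (Hpl := nth_error_lt _ _ _ Hp). assert (Hql := nth_error_lt _ _ _ Hq).
  split; intros (p' & H1 & H2).
  - assert (p' = g p) as -> by eauto using nth_error_inj.
    assert (E : f (g p) = g q) by eauto using nth_error_inj.
    rewrite <- Hcom in E by auto. apply Hinj in E; [|now apply (Hcut p)|auto].
    exists p. split; auto. rewrite E. auto.
  - exists (g p'). split; [auto|].
    rewrite <- Hcom by eauto using nth_error_lt. auto.
Qed.

Lemma graph_on_prefix c w : stage c -> stage w -> prefix c w ->
  forall a b, a < length c -> b < length c ->
    (graph_on w a b <-> graph_on c a b).
Proof.
  intros Hc (Hw & _) H. apply (graph_on_placed (fun p => p)); auto.
Qed.

(** New elements may be inserted anywhere except among the first [r] positions, which are protected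
    for requirements of higher priority. *)
Definition extends (r : nat) (w w' : list nat) : Prop :=
  exists g, incr_on g 0 (length w) /\ (forall p, p < r -> g p = p) /\
    placed g w w'.

Lemma extends_prefix b r w w' :
  extends r w w' -> length b <= r -> prefix b w -> prefix b w'.
Proof.
  intros (g & _ & Hg & Hp) Hb H p x Hx.
  rewrite <- (Hg p) by (apply nth_error_lt in Hx; lia). auto.
Qed.

Lemma grow w : stage w ->
  exists w', stage w' /\ length w < length w' /\ prefix w w'.
Proof.
  intros Hw. destruct (cuts_unbounded (length w)) as (m & Hm & Hc).
  destruct (spread w m (fun p => p)) as (w' & H1 & H2 & H3); auto; try lia.
  - intros p q _ Hpq _; exact Hpq.
  - exists w'. split; [auto|]. split; [lia|auto].
Qed.

Definition shift (r t p : nat) : nat := if p <? r then p else p + t.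

(** The positions [p] and [f p] lie above [base], whose length is a cut. Inserting [t] elements
    right above [base] shifts both by [t], and [shift_breaks] provides [t] with
    [f (p + t) <> f p + t]. *)
Lemma destroy base w x y : stage base -> stage w -> prefix base w ->
  ~ In x base -> x <> y -> graph_on w x y ->
  exists w', stage w' /\ length w < length w' /\ extends (length base) w w' /\
    (exists t, placed (shift (length base) t) w w') /\ ~ graph_on w' x y.
Proof.
  intros (_ & _ & Hbc) Hw Hb Hx Hxy (p & Hp & Hfp).
  assert (Hpb : length base <= p).
  { destruct (Nat.le_gt_cases (length base) p) as [|Hlt]; auto.
    destruct (nth_error_ex _ _ Hlt) as (x' & Hx'). assert (H := Hb _ _ Hx').
    cbv beta in H. apply nth_error_In in Hx'. congruence. }
  assert (Hfpb : length base <= f p).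
  { specialize (Hbc p). lia. }
  destruct (shift_breaks p (f p)) as (t & Ht).
  { intros E. rewrite <- E in Hfp. congruence. }
  destruct (cuts_unbounded (length w + t)) as (m & Hm & Hc).
  assert (Hs : incr_on (shift (length base) t) 0 (length w)).
  { intros i j Hi Hij Hj. unfold shift.
    destruct (Nat.ltb_spec i (length base)), (Nat.ltb_spec j (length base)); lia. }
  destruct (spread w m (shift (length base) t)) as (w' & H1 & H2 & H3); auto.
  - lia.
  - intros i Hi. unfold shift. destruct (i <? length base); lia.
  - exists w'. split; [auto|]. split; [lia|]. split; [|split].
    + exists (shift (length base) t). split; [auto|]. split; [|auto].
      intros i Hi. unfold shift.
      destruct (Nat.ltb_spec i (length base)); [auto|lia].
    + eauto.
    + intros (q & Hq & Hfq). destruct H1 as (Hnd & _).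
      apply H3 in Hp. apply H3 in Hfp.
      assert (q = p + t) as ->.
      { rewrite (nth_error_inj _ _ _ _ Hnd Hq Hp). unfold shift.
        destruct (Nat.ltb_spec p (length base)); [lia|auto]. }
      apply Ht. rewrite (nth_error_inj _ _ _ _ Hnd Hfq Hfp). unfold shift.
      destruct (Nat.ltb_spec (f p) (length base)); [lia|auto].
Qed.

(** The part of [c] above [base] is moved along an embedding into far later blocks. Together with
    the identity on [base] this commutes with [f], so f^L on the elements of [c] becomes what it was
    in [c]. *)
Lemma restore base c w t : stage base -> stage c -> stage w ->
  N <= length base -> prefix base c -> placed (shift (length base) t) c w ->
  exists w', stage w' /\ length w < length w' /\ extends (length base) w w' /\
    forall a b, a < length c -> b < length c ->
      (graph_on w' a b <-> graph_on c a b).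
Proof.
  intros Hb Hc Hw HNb Hpre Hsh.
  set (r := length base) in *.
  assert (Hrc : r <= length c) by (apply prefix_length; auto).
  destruct (embed_far r (r + t)) with (p := length c) as (H & H1 & H2 & H3);
    auto; [apply Hb|apply Hc|].
  destruct (bounded_on H (length c)) as (B & HB).
  (* Positions below [r + t], namely [base] and the elements inserted by the shift, stay. Those of
     the rest of [c] follow [H], whose values are at least [r + t], and all later ones jump beyond
     the bound [B]. *)
  set (g := fun p => if p <? r + t then p else
    if p <? length c + t then H (p - t) else B + p).
  assert (Hg : incr_on g 0 (length w)).
  { intros i j Hi Hij Hj. unfold g.
    destruct (Nat.ltb_spec i (r + t)), (Nat.ltb_spec j (r + t)),
      (Nat.ltb_spec i (length c + t)), (Nat.ltb_spec j (length c + t)); try lia.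
    - specialize (H2 (j - t)). lia.
    - apply H1; lia.
    - specialize (HB (i - t)). lia. }
  destruct (cuts_unbounded (B + length w)) as (m & Hm & Hmc).
  destruct (spread w m g) as (w' & K1 & K2 & K3); auto; [lia| |].
  { intros p Hp. unfold g.
    destruct (Nat.ltb_spec p (r + t)), (Nat.ltb_spec p (length c + t)); try lia.
    specialize (HB (p - t)). lia. }
  exists w'. split; [auto|]. split; [lia|]. split.
  - exists g. split; [auto|]. split; [|auto]. intros p Hp. unfold g.
    destruct (Nat.ltb_spec p (r + t)); lia.
  - set (k := fun p => if p <? r then p else H p).
    assert (Ek : forall p, p < length c -> g (shift r t p) = k p).
    { intros p Hp. unfold g, shift, k. destruct (Nat.ltb_spec p r).
      - destruct (Nat.ltb_spec p (r + t)); lia.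
      - destruct (Nat.ltb_spec (p + t) (r + t)); [lia|].
        destruct (Nat.ltb_spec (p + t) (length c + t)); [f_equal; lia|lia]. }
    assert (Hk : incr_on k 0 (length c)).
    { intros i j Hi Hij Hj. unfold k.
      destruct (Nat.ltb_spec i r), (Nat.ltb_spec j r); try lia.
      - specialize (H2 j). lia.
      - apply H1; lia. }
    apply (graph_on_placed k); auto.
    + apply K1.
    + intros p x Hx. rewrite <- Ek by eauto using nth_error_lt. auto.
    + intros p q. apply incr_on_inj. auto.
    + intros p Hp. destruct Hb as (_ & _ & Hbc). specialize (Hbc p).
      fold r in Hbc. unfold k.
      destruct (Nat.ltb_spec p r), (Nat.ltb_spec (f p) r); try lia.
      apply H3. lia.
Qed.
End Blocks.

(** * The construction *)

Lemma to_nat_ge a b : a <= to_nat (a, b) /\ b <= to_nat (a, b).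
Proof. pose proof (to_nat_non_decreasing a b). lia. Qed.

Lemma to_nat_mono a b a' b' :
  a <= a' -> b <= b' -> to_nat (a, b) <= to_nat (a', b').
Proof.
  intros Ha Hb. pose proof (to_nat_spec a b). pose proof (to_nat_spec a' b').
  nia.
Qed.

Lemma join_agree k A B A' B' :
  (forall n, n < k -> (A n <-> A' n)) -> agree k B B' ->
  agree k (join A B) (join A' B').
Proof.
  intros HA HB n Hn. unfold join.
  split; (intros [(m & E & H)|(m & E & H)]; [left|right]; exists m;
    (split; [auto|])); (apply HA || apply HB); auto; lia.
Qed.

Lemma suffix_compare {A} (l l' T T' : list A) :
  l ++ T = l' ++ T' -> length T <= length T' -> exists k, T' = k ++ T.
Proof.
  intros E H. apply app_eq_app in E as (k & [[-> ->]|[-> ->]]); [eauto|].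
  rewrite length_app in H. destruct k; [|cbn in H; lia]. exists []. auto.
Qed.

(* An attack of a requirement X = Phi^(f^L + A), f^L = Psi^X: at stage
   [att_stage] the set X looked like [att_guess] below [att_use], Phi agreed
   with this guess, and Psi computed from it that f^L maps [att_arg] to
   [att_val]. *)
Record attack := Attack {
  att_stage : nat;
  att_use : nat;
  att_guess : nat -> nat;
  att_arg : nat;
  att_val : nat
}.

(* [Armed a]: f^L is in the configuration from which Phi computes the guess;
   [Diverted a c]: f^L differs at the argument of the attack, but the
   configuration [c] can be restored. *)
Inductive phase :=
| Waiting
| Armed (a : attack)
| Diverted (a : attack) (c : list nat).

Definition attack_of (p : phase) : option attack :=
  match p with
  | Waiting => None
  | Armed a => Some a
  | Diverted a _ => Some a
  end.

Definition entry : Type := list nat * phase.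

Definition req_index (i : nat) : nat := fst (of_nat i).
Definition req_Phi (i : nat) : functional :=
  functional_of (fst (of_nat (snd (of_nat i)))).
Definition req_Psi (i : nat) : functional :=
  functional_of (snd (of_nat (snd (of_nat i)))).

Lemma req_ex e c d :
  exists i, req_index i = e /\ req_Phi i = c /\ req_Psi i = d.
Proof.
  exists (to_nat (e, to_nat (functional_code c, functional_code d))).
  unfold req_index, req_Phi, req_Psi. rewrite !cancel_of_to. cbn [fst snd].
  rewrite !cancel_of_to. cbn [fst snd]. rewrite !functional_of_code. auto.
Qed.

(* The construction sees the oracle through [I], whose value at n codes the
   n-th bit of A and the value of Gamma^A at n. *)
Definition bits (I : nat -> nat) (n : nat) : Prop := fst (of_nat (I n)) = 1.

Definition approx (I : nat -> nat) (e x s : nat) : nat :=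
  snd (of_nat (I (to_nat (e, to_nat (x, s))))).

(** Large enough for stage [s] to see the oracle below [s] and the approximations at [s] with index
    and argument at most [s]. *)
Definition visible (s : nat) : nat := S (to_nat (s, to_nat (s, s))).

(** Values beyond the bound become the default 0, so that even the noncomputable choices made at a
    stage depend on finitely many values of [I]. *)
Definition cutoff (I : nat -> nat) (s k : nat) : nat :=
  if k <? visible s then I k else 0.

Lemma bits_cutoff I s : agree s (bits (cutoff I s)) (bits I).
Proof.
  intros n Hn. unfold bits, cutoff, visible.
  destruct (to_nat_ge s (to_nat (s, s))) as [H _].
  destruct (Nat.ltb_spec n (S (to_nat (s, to_nat (s, s))))); [tauto|lia].
Qed.

Lemma approx_cutoff I e x s : e <= s -> x <= s ->
  approx (cutoff I s) e x s = approx I e x s.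
Proof.
  intros He Hx. unfold approx, cutoff, visible.
  assert (H : to_nat (e, to_nat (x, s)) <= to_nat (s, to_nat (s, s)))
    by auto using to_nat_mono.
  destruct (Nat.ltb_spec (to_nat (e, to_nat (x, s)))
    (S (to_nat (s, to_nat (s, s))))); [auto|lia].
Qed.

Section Construction.
Context (f : nat -> nat) (f_block : block_function f).
Context (base0 : list nat) (Hbase0 : stage f base0).

(** A finite oracle is represented by all sets extending it. The input is the place of the pair in
    the even half of the join. *)
Definition psi_sees (i : nat) (a : attack) : Prop :=
  forall B, (forall z, z < att_use a -> chi B z = att_guess a z) ->
    eval B (req_Psi i) (2 * to_nat (att_arg a, att_val a)) 1.

(** The stage of the attack doubles as a bound on the use of Phi. *)
Definition phi_forces (i : nat) (A : nat -> Prop) (a : attack) (w : list nat) : Prop :=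
  forall B, agree (att_stage a) (join (graph_of_rel (graph_on f w)) A) B ->
    forall z, z < att_use a -> eval B (req_Phi i) z (att_guess a z).

(* The stack lists the requirements in order of decreasing index; each entry
   stores the whole order at the time of its last action. *)
Definition current (st : list entry) : list nat :=
  match st with
  | [] => base0
  | (w, _) :: _ => w
  end.

(** The actions are to start an attack, to divert it when the approximation matches the guess, and
    to restore the saved order once it differs. The order [base] belongs to higher priority and is
    not disturbed. *)
Definition reacts (s : nat) (I : nat -> nat) (i : nat) (base w : list nat)
    (r r' : entry) : Prop :=
  stage f (fst r') /\ length w < length (fst r') /\
  extends (length base) w (fst r') /\
  match snd r with
  | Waiting => exists a,
      snd r' = Armed a /\ att_stage a = s /\ att_use a <= s /\
      (forall z, z < att_use a -> approx I (req_index i) z s = att_guess a z) /\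
      att_arg a <> att_val a /\ ~ In (att_arg a) base /\
      graph_on f (fst r') (att_arg a) (att_val a) /\
      psi_sees i a /\ phi_forces i (bits I) a (fst r')
  | Armed a =>
      snd r' = Diverted a w /\
      (forall z, z < att_use a -> approx I (req_index i) z s = att_guess a z) /\
      (exists t, placed (shift (length base) t) w (fst r')) /\
      ~ graph_on f (fst r') (att_arg a) (att_val a)
  | Diverted a c =>
      snd r' = Armed a /\
      (exists z, z < att_use a /\ approx I (req_index i) z s <> att_guess a z) /\
      forall x y, x < length c -> y < length c ->
        (graph_on f (fst r') x y <-> graph_on f c x y)
  end.

Definition react s I i base w r : option entry :=
  match excluded_middle_informative (exists r', reacts s I i base w r r') with
  | left H => Some (proj1_sig (constructive_indefinite_description _ H))
  | right _ => None
  end.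

(** The tail is asked first, so the entry of least index that can act does so; the entries in front
    of it are dropped and thus injured. The index of an entry is the length of its tail. *)
Fixpoint attend (s : nat) (I : nat -> nat) (w : list nat) (st : list entry) :
    option (list entry) :=
  match st with
  | [] => None
  | r :: tl =>
      match attend s I w tl with
      | Some st' => Some st'
      | None =>
          match react s I (length tl) (current tl) w r with
          | Some r' => Some (r' :: tl)
          | None => None
          end
      end
  end.

Definition grown (w : list nat) : list nat :=
  epsilon (inhabits []) (fun w' =>
    stage f w' /\ length w < length w' /\ prefix w w').

Lemma grown_spec w : stage f w ->
  stage f (grown w) /\ length w < length (grown w) /\ prefix w (grown w).
Proof.
  intros Hw. apply (epsilon_spec (inhabits []) (fun w' =>
    stage f w' /\ length w < length w' /\ prefix w w')).
  apply grow; auto.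
Qed.

Definition next (s : nat) (I : nat -> nat) (st : list entry) : list entry :=
  match attend s I (current st) st with
  | Some st' => st'
  | None => (grown (current st), Waiting) :: st
  end.

Fixpoint run (I : nat -> nat) (s : nat) : list entry :=
  match s with
  | 0 => []
  | S s => next s (cutoff I s) (run I s)
  end.

Definition order_at (I : nat -> nat) (s : nat) : list nat := current (run I s).

Lemma run_continuous s : exists m, forall I J,
  (forall k, k < m -> I k = J k) -> run I s = run J s.
Proof.
  induction s as [|s (m & Hm)]; [exists 0; auto|].
  exists (m + visible s). intros I J H. cbn [run].
  rewrite (Hm I J) by (intros; apply H; lia).
  replace (cutoff J s) with (cutoff I s); [auto|].
  apply functional_extensionality. intros k. unfold cutoff.
  destruct (Nat.ltb_spec k (visible s)); [apply H; lia|auto].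
Qed.

Definition quiet s I w (T : list entry) : Prop :=
  forall l r tl, T = l ++ r :: tl ->
    ~ exists r', reacts s I (length tl) (current tl) w r r'.

Lemma quiet_suffix s I w l T : quiet s I w (l ++ T) -> quiet s I w T.
Proof.
  intros H k r tl ->. apply (H (l ++ k)). now rewrite <- app_assoc.
Qed.

Lemma attend_spec s I w st :
  match attend s I w st with
  | Some st' => exists l r tl r', st = l ++ r :: tl /\ st' = r' :: tl /\
      reacts s I (length tl) (current tl) w r r' /\ quiet s I w tl
  | None => quiet s I w st
  end.
Proof.
  induction st as [|r tl IH]; cbn [attend].
  - intros l r tl E. now destruct l.
  - destruct (attend s I w tl) as [st'|].
    + destruct IH as (l & r1 & tl1 & r' & -> & H).
      exists (r :: l), r1, tl1, r'. auto.
    + unfold react. destruct excluded_middle_informative as [H|H].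
      * destruct constructive_indefinite_description as [r' Hr']. cbn.
        exists [], r, tl, r'. auto.
      * intros [|r0 l] r1 tl1 E; cbn in E; injection E as -> E; [now subst|].
        eapply IH; eauto.
Qed.

Lemma next_spec s I st :
  (exists l r tl r', st = l ++ r :: tl /\ next s I st = r' :: tl /\
    reacts s I (length tl) (current tl) (current st) r r' /\
    quiet s I (current st) tl) \/
  (quiet s I (current st) st /\
   next s I st = (grown (current st), Waiting) :: st).
Proof.
  unfold next. assert (H := attend_spec s I (current st) st).
  destruct (attend s I (current st) st) as [st'|]; [left|right]; auto.
Qed.

(** * Invariants of a run *)

Section Run.
Context (I : nat -> nat).

(** A diverted attack keeps its properties in the saved order [c], which sits in the stored order
    shifted above [base]; this is what [restore] needs. *)
Definition entry_ok (i : nat) (base : list nat) (r : entry) : Prop :=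
  match snd r with
  | Waiting => True
  | Armed a =>
      att_arg a <> att_val a /\ ~ In (att_arg a) base /\ psi_sees i a /\
      att_stage a <= length (fst r) /\
      graph_on f (fst r) (att_arg a) (att_val a) /\
      phi_forces i (bits I) a (fst r)
  | Diverted a c =>
      (att_arg a <> att_val a /\ ~ In (att_arg a) base /\ psi_sees i a /\
      att_stage a <= length c /\
      graph_on f c (att_arg a) (att_val a) /\
      phi_forces i (bits I) a c) /\
      stage f c /\ prefix base c /\
      (exists t, placed (shift (length base) t) c (fst r)) /\
      ~ graph_on f (fst r) (att_arg a) (att_val a)
  end.

Fixpoint stack_ok (st : list entry) : Prop :=
  match st with
  | [] => True
  | r :: tl => stack_ok tl /\ stage f (fst r) /\ prefix (current tl) (fst r) /\
      length (current tl) < length (fst r) /\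
      entry_ok (length tl) (current tl) r
  end.

Lemma stack_ok_stage st : stack_ok st -> stage f (current st).
Proof. destruct st as [|[w p] tl]; cbn; tauto. Qed.

Lemma stack_ok_prefix l T : stack_ok (l ++ T) ->
  stack_ok T /\ prefix (current T) (current (l ++ T)).
Proof.
  induction l as [|[w p] l IH]; cbn [app stack_ok].
  - intros H. split; [auto|apply prefix_refl].
  - intros (H1 & H2 & H3 & H4). destruct (IH H1) as [K1 K2].
    split; [auto|]. eapply prefix_trans; eauto.
Qed.

Lemma stack_ok_length st :
  stack_ok st -> length base0 + length st <= length (current st).
Proof.
  induction st as [|[w p] tl IH]; cbn; [lia|].
  intros (H1 & _ & _ & H2 & _). specialize (IH H1). lia.
Qed.

Lemma graph_on_lt w x y : stage f w -> graph_on f w x y ->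
  x < length w /\ y < length w.
Proof.
  intros (_ & Hin & _) (p & H1 & H2).
  split; apply Hin; eauto using nth_error_In.
Qed.

(** A code bounds its components, so below a use of at most [length c] only pairs of elements of [c]
    matter. *)
Lemma phi_forces_transfer i A A' a c w :
  (forall x y, x < length c -> y < length c ->
    (graph_on f w x y <-> graph_on f c x y)) ->
  agree (att_stage a) A' A -> att_stage a <= length c ->
  phi_forces i A a c -> phi_forces i A' a w.
Proof.
  intros Hg HA Hs H B HB. apply H. eapply agree_trans; [|exact HB].
  apply join_agree; [|apply agree_sym; auto].
  intros n Hn. unfold graph_of_rel.
  split; intros (x & y & -> & Hxy); exists x, y; (split; [auto|]);
    destruct (to_nat_ge x y); apply Hg; auto; lia.
Qed.

Lemma reacts_ok s i base w r r' :
  stage f w -> prefix (fst r) w -> stage f (fst r) -> s <= length w ->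
  prefix base (fst r) -> entry_ok i base r ->
  reacts s (cutoff I s) i base w r r' -> entry_ok i base r'.
Proof.
  intros Hw Hrw Hr Hs Hb Hok (H1 & H2 & H3 & H4).
  assert (Hl := prefix_length _ _ Hrw).
  unfold entry_ok in *. destruct (snd r) as [|a|a c].
  - destruct H4 as (a & -> & E1 & E2 & E3 & E4 & E5 & E6 & E7 & E8).
    do 3 (split; [auto|]). split; [lia|]. split; [auto|].
    apply (phi_forces_transfer i (bits (cutoff I s)) (bits I) a (fst r')); auto.
    + tauto.
    + rewrite E1. apply agree_sym, bits_cutoff.
    + lia.
  - destruct H4 as (-> & E1 & E2 & E3).
    destruct Hok as (K1 & K2 & K3 & K4 & K5 & K6).
    assert (Hg := graph_on_prefix f _ _ Hr Hw Hrw).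
    split; [|split; [auto|split; [|auto]]].
    + do 3 (split; [auto|]). split; [lia|]. split.
      * destruct (graph_on_lt _ _ _ Hr K5). apply Hg; auto.
      * apply (phi_forces_transfer i (bits I) (bits I) a (fst r)); auto.
        intros n; tauto.
    + eapply prefix_trans; eauto.
  - destruct H4 as (-> & E1 & E2).
    destruct Hok as ((K1 & K2 & K3 & K4 & K5 & K6) & L1 & L2 & (t & L3) & L4).
    destruct (graph_on_lt _ _ _ L1 K5) as [Hx Hy].
    do 3 (split; [auto|]). split; [|split].
    (* The position of the last element of [c] shows that [fst r] is at least as long as [c]. *)
    + destruct (nth_error_ex c (length c - 1)) as (x & Hp); [lia|].
      apply L3, nth_error_lt in Hp. unfold shift in Hp.
      destruct (length c - 1 <? length base); lia.
    + apply E2; auto.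
    + apply (phi_forces_transfer i (bits I) (bits I) a c); auto.
      intros n; tauto.
Qed.

(** The length bound holds because every stage strictly lengthens the order; it guarantees that [x]
    is placed by stage [x + 1]. *)
Lemma run_ok s : stack_ok (run I s) /\ s <= length (order_at I s).
Proof.
  unfold order_at. induction s as [|s [IH Hs]]; cbn [run].
  - split; [exact Logic.I|lia].
  - assert (Hst := stack_ok_stage _ IH).
    destruct (next_spec s (cutoff I s) (run I s)) as
      [(l & r & tl & r' & E & -> & Hr & _)|[_ ->]].
    + rewrite E in IH. destruct (stack_ok_prefix _ _ IH) as [K1 K2].
      rewrite <- E in K2. destruct K1 as (K3 & K4 & K5 & K6 & K7).
      assert (Hrw : prefix (fst r) (current (run I s))).
      { destruct r as [w p]. exact K2. }
      assert (Hok := reacts_ok _ _ _ _ _ _ Hst Hrw K4 Hs K5 K7 Hr).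
      destruct Hr as (R1 & R2 & R3 & _).
      assert (Hc : current (r' :: tl) = fst r') by now destruct r'.
      rewrite Hc. apply prefix_length in Hrw.
      split; [|lia]. split; [auto|]. split; [auto|].
      split; [|split; [lia|auto]].
      eapply extends_prefix; [exact R3|auto|].
      eapply prefix_trans; [exact K5|]. destruct r as [w p]. exact K2.
    + destruct (grown_spec _ Hst) as (G1 & G2 & G3). cbn.
      split; [|lia]. do 4 (split; [auto|]). exact Logic.I.
Qed.

Lemma order_stage s : stage f (order_at I s).
Proof. apply stack_ok_stage, run_ok. Qed.

Lemma order_extends s : exists r, extends r (order_at I s) (order_at I (S s)).
Proof.
  unfold order_at. cbn [run]. assert (Hst := order_stage s).
  destruct (next_spec s (cutoff I s) (run I s)) as
    [(l & r & tl & r' & E & -> & (_ & _ & H & _) & _)|[_ ->]].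
  - exists (length (current tl)). now destruct r'.
  - exists 0, (fun p => p). destruct (grown_spec _ Hst) as (G1 & G2 & G3).
    split; [intros p q _ H _; exact H|]. split; auto.
Qed.

(** * Requirements settle *)

Definition settled (T : list entry) (s0 : nat) : Prop :=
  forall s, s0 <= s -> exists l, run I s = l ++ T.

(** If an entry of [T] acted, the new stack would be no longer than [T], hence equal to [T]. Its top
    order would then be longer than the order at stage [s], of which it is a prefix. *)
Lemma settled_quiet T s0 s : settled T s0 -> s0 <= s ->
  quiet s (cutoff I s) (order_at I s) T.
Proof.
  intros HT Hs. destruct (HT s Hs) as (l & El).
  destruct (HT (S s) ltac:(lia)) as (l2 & El2). cbn [run] in El2.
  assert (Hok := proj1 (run_ok s)).
  destruct (next_spec s (cutoff I s) (run I s)) as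
    [(l1 & r & tl & r' & E & E' & Hr & Hq)|[Hq _]].
  - destruct (Nat.le_gt_cases (length T) (length tl)) as [Hle|Hlt].
    + rewrite E in El. change (r :: tl) with ([r] ++ tl) in El.
      rewrite app_assoc in El.
      destruct (suffix_compare l (l1 ++ [r]) T tl) as (k & ->); auto.
      eapply quiet_suffix; exact Hq.
    + exfalso. rewrite E' in El2. assert (ET : r' :: tl = T).
      { assert (HL := f_equal (@length _) El2). rewrite length_app in HL.
        cbn [length] in HL. destruct l2; [auto|cbn [length] in HL; lia]. }
      rewrite El in Hok. destruct (stack_ok_prefix _ _ Hok) as [_ Hp].
      rewrite <- El in Hp. apply prefix_length in Hp. rewrite <- ET in Hp.
      destruct Hr as (_ & Hr & _). destruct r' as [w' p']. cbn in *. lia.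
  - rewrite El in Hq at 2. eapply quiet_suffix; exact Hq.
Qed.

(** As [T] is quiet, either [r] acts, or an entry in front of it does, or a new entry is pushed. *)
Lemma settled_step T s0 s l r : settled T s0 -> s0 <= s ->
  run I s = l ++ r :: T ->
  (exists r', reacts s (cutoff I s) (length T) (current T) (order_at I s) r r' /\
    run I (S s) = r' :: T) \/
  ((~ exists r', reacts s (cutoff I s) (length T) (current T) (order_at I s) r r') /\
    exists l', run I (S s) = l' ++ r :: T).
Proof.
  intros HT Hs El. assert (HqT := settled_quiet _ _ _ HT Hs).
  cbn [run]. destruct (next_spec s (cutoff I s) (run I s)) as
    [(l1 & r1 & tl & r' & E & -> & Hr & Hq)|[Hq ->]].
  - destruct (Nat.lt_trichotomy (length tl) (length T)) as [H|[H|H]].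
    + exfalso. rewrite E in El. change (r :: T) with ([r] ++ T) in El.
      rewrite app_assoc in El. symmetry in El.
      destruct (suffix_compare l1 (l ++ [r]) (r1 :: tl) T) as (k & ET); auto.
      apply (HqT k r1 tl ET). eauto.
    + left. rewrite E in El.
      destruct (suffix_compare l1 l (r1 :: tl) (r :: T)) as (k & Ek); auto.
      { cbn; lia. }
      destruct k as [|e k].
      * injection Ek as -> ->. exists r'. auto.
      * assert (HL := f_equal (@length _) Ek). cbn in HL.
        rewrite length_app in HL. cbn in HL. lia.
    + right. rewrite E in El. change (r1 :: tl) with ([r1] ++ tl) in El.
      rewrite app_assoc in El. symmetry in El.
      destruct (suffix_compare l (l1 ++ [r1]) (r :: T) tl) as (k & ->); auto.
      split; [eapply Hq; eauto|]. exists (r' :: k). auto.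
  - right. split; [eapply Hq; eauto|].
    exists ((grown (current (run I s)), Waiting) :: l). rewrite El at 2. auto.
Qed.

Lemma settled_or_reacts T s0 s1 l r : settled T s0 -> s0 <= s1 ->
  run I s1 = l ++ r :: T ->
  settled (r :: T) s1 \/ exists s r', s1 <= s /\
    reacts s (cutoff I s) (length T) (current T) (order_at I s) r r' /\
    run I (S s) = r' :: T.
Proof.
  intros HT Hs El.
  destruct (classic (exists s r', s1 <= s /\
    reacts s (cutoff I s) (length T) (current T) (order_at I s) r r' /\
    run I (S s) = r' :: T)) as [H|H]; [auto|left].
  intros s Hs1. induction s as [|s IH].
  - replace s1 with 0 in El by lia. eauto.
  - destruct (Nat.eq_dec s1 (S s)) as [->|]; [eauto|].
    destruct IH as (k & Ek); [lia|].
    destruct (settled_step _ _ s _ _ HT ltac:(lia) Ek) as [(r' & H1 & H2)|[_ ?]];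
      [|auto].
    exfalso. apply H. exists s, r'. split; [lia|auto].
Qed.

Context (X : nat -> nat -> Prop).
Context (HX : forall e x, exists s0, forall s, s0 <= s -> approx I e x s = chi (X e) x).

Lemma approx_below e u : exists s0, forall s, s0 <= s -> forall z, z < u ->
  approx (cutoff I s) e z s = chi (X e) z.
Proof.
  destruct (bounded_choice (fun z s0 => forall s, s0 <= s ->
    approx I e z s = chi (X e) z) u) as (s0 & H).
  - intros z s0 s1 Hle H s Hs. apply H. lia.
  - intros z _. apply HX.
  - exists (s0 + e + u). intros s Hs z Hz.
    rewrite approx_cutoff by lia. apply H; lia.
Qed.

(** With [T] settled nothing of higher priority discards the entry, and its own actions keep the
    attack. *)
Lemma attack_persists T s0 s1 l r a : settled T s0 -> s0 <= s1 ->
  run I s1 = l ++ r :: T -> attack_of (snd r) = Some a ->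
  forall s, s1 <= s -> exists l r, run I s = l ++ r :: T /\
    attack_of (snd r) = Some a.
Proof.
  intros HT Hs El Ha s Hs1. induction Hs1 as [|s Hs1 IH]; [eauto|].
  destruct IH as (k & r1 & Ek & Ha1).
  destruct (settled_step _ _ s _ _ HT ltac:(lia) Ek) as
    [(r' & (_ & _ & _ & H) & E)|[_ (k' & E)]]; [|eauto].
  exists [], r'. split; [auto|].
  destruct (snd r1) as [|a1|a1 c]; cbn in Ha1; [discriminate| |];
    injection Ha1 as ->; destruct H as (-> & _); auto.
Qed.

(** Once the approximation has converged below the use, its comparison with the guess is constant.
    If they match, [Diverted] is final, otherwise [Armed] is, so at most one more action follows. *)
Lemma attack_settles T s0 s1 l r a : settled T s0 -> s0 <= s1 ->
  run I s1 = l ++ r :: T -> attack_of (snd r) = Some a ->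
  exists r' s2, settled (r' :: T) s2.
Proof.
  intros HT Hs El Ha.
  destruct (approx_below (req_index (length T)) (att_use a)) as (s2 & H2).
  assert (Hp := attack_persists _ _ _ _ _ _ HT Hs El Ha).
  (* [P] describes the final phase: no action is possible in it, and any action from another phase
     of the attack leads into it. *)
  assert (Hcase : forall P : phase -> Prop,
    (forall s r r', s1 + s2 <= s -> attack_of (snd r) = Some a -> P (snd r) ->
      ~ reacts s (cutoff I s) (length T) (current T) (order_at I s) r r') ->
    (forall s r r', s1 + s2 <= s -> attack_of (snd r) = Some a -> ~ P (snd r) ->
      reacts s (cutoff I s) (length T) (current T) (order_at I s) r r' ->
      P (snd r')) ->
    exists r' s2, settled (r' :: T) s2).
  { intros P HP1 HP2.
    assert (HP : forall s l r, s1 + s2 <= s -> run I s = l ++ r :: T ->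
      attack_of (snd r) = Some a -> P (snd r) ->
      exists r' s2, settled (r' :: T) s2).
    { intros s k r1 Hs1 Ek Ha1 HPr. exists r1, s.
      destruct (settled_or_reacts _ _ s _ _ HT ltac:(lia) Ek) as
        [|(s' & r' & Hs' & Hr' & _)]; [auto|].
      exfalso. eapply (HP1 s' r1 r'); eauto; lia. }
    destruct (Hp (s1 + s2) ltac:(lia)) as (k & r1 & Ek & Ha1).
    destruct (settled_or_reacts _ _ (s1 + s2) _ _ HT ltac:(lia) Ek) as
      [|(s' & r' & Hs' & Hr' & Er')]; [eauto|].
    destruct (Hp (S s') ltac:(lia)) as (k' & r2 & Ek' & Ha2).
    assert (r2 = r') as ->.
    { rewrite Er' in Ek'. destruct k' as [|e k'].
      - now injection Ek'.
      - assert (HL := f_equal (@length _) Ek'). cbn in HL.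
        rewrite length_app in HL. cbn in HL. lia. }
    apply (HP (S s') [] r'); auto.
    apply (HP2 s' r1 r'); auto.
    intros HPr. eapply (HP1 s' r1 r'); eauto. }
  destruct (classic (forall z, z < att_use a ->
    chi (X (req_index (length T))) z = att_guess a z)) as [Hm|Hm].
  - apply (Hcase (fun p => exists c, p = Diverted a c)).
    + intros s q q' Hs' Ha' (c & E) (_ & _ & _ & H). rewrite E in H.
      destruct H as (_ & (z & Hz & Hne) & _).
      rewrite H2 in Hne by lia. auto.
    + intros s q q' Hs' Ha' HP (_ & _ & _ & H).
      destruct (snd q) as [|a'|a' c]; cbn in Ha'; [discriminate| |];
        injection Ha' as ->; [|exfalso; eauto].
      destruct H as (-> & _). eauto.
  - apply (Hcase (fun p => p = Armed a)).
    + intros s q q' Hs' Ha' E (_ & _ & _ & H). rewrite E in H.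
      destruct H as (_ & H & _). apply Hm. intros z Hz.
      rewrite <- (H2 s ltac:(lia) z Hz). auto.
    + intros s q q' Hs' Ha' HP (_ & _ & _ & H).
      destruct (snd q) as [|a'|a' c]; cbn in Ha'; [discriminate| |];
        injection Ha' as ->; [exfalso; eauto|].
      destruct H as (-> & _). auto.
Qed.

(** An entry appears on top of [T], since a bare quiet [T] gets a new one pushed. It waits forever
    or starts an attack, and attacks settle. *)
Lemma settled_succ T s0 : settled T s0 -> exists r s1, settled (r :: T) s1.
Proof.
  intros HT.
  assert (H0 : exists s1 l r, s0 <= s1 /\ run I s1 = l ++ r :: T).
  { destruct (HT s0 ltac:(lia)) as (l & El).
    destruct l as [|r0 l0] using rev_ind.
    - assert (Hq := settled_quiet _ _ s0 HT ltac:(lia)).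
      exists (S s0), []. cbn [run].
      destruct (next_spec s0 (cutoff I s0) (run I s0)) as
        [(l1 & r & tl & r' & E & _ & Hr & _)|[_ ->]].
      + exfalso. rewrite El in E at 1. apply (Hq _ _ _ E). eauto.
      + eexists. split; [lia|]. exact (f_equal (cons _) El).
    - exists s0, l0, r0. split; [lia|]. rewrite El, <- app_assoc. auto. }
  destruct H0 as (s1 & l & r & Hs & El).
  destruct (attack_of (snd r)) as [a|] eqn:Ha; [eauto using attack_settles|].
  destruct (settled_or_reacts _ _ s1 _ _ HT Hs El) as
    [|(s' & r' & Hs' & (_ & _ & _ & Hr') & Er')]; [eauto|].
  destruct (snd r); try discriminate. destruct Hr' as (a & Ea & _).
  apply (attack_settles T s0 (S s') [] r' a); auto; [lia|].
  rewrite Ea. auto.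
Qed.

Lemma settled_all i : exists T s0, length T = i /\ settled T s0.
Proof.
  induction i as [|i (T & s0 & Hl & HT)].
  - exists [], 0. split; [auto|]. intros s _. exists (run I s).
    now rewrite app_nil_r.
  - destruct (settled_succ T s0 HT) as (r & s1 & Hr).
    exists (r :: T), s1. cbn. auto.
Qed.

(** * The limit copy *)

Definition before (w : list nat) (x y : nat) : Prop :=
  exists p q, nth_error w p = Some x /\ nth_error w q = Some y /\ p < q.

(** Stage [x + y + 1] already contains both elements, and later stages preserve relative order, so a
    finite stage decides the limit order. *)
Definition run_prec (x y : nat) : Prop := before (order_at I (S (x + y))) x y.

Lemma before_iff w p q x y : stage f w ->
  nth_error w p = Some x -> nth_error w q = Some y -> (before w x y <-> p < q).
Proof.
  intros (Hnd & _) Hp Hq. split; [|exists p, q; auto].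
  intros (p' & q' & Hp' & Hq' & H).
  rewrite (nth_error_inj _ _ _ _ Hnd Hp Hp'), (nth_error_inj _ _ _ _ Hnd Hq Hq').
  auto.
Qed.

Lemma stage_position w x : stage f w -> x < length w ->
  exists p, nth_error w p = Some x.
Proof. intros (_ & Hin & _) H. apply In_nth_error, Hin, H. Qed.

Lemma before_extends r w w' x y : stage f w -> stage f w' -> extends r w w' ->
  x < length w -> y < length w -> (before w x y <-> before w' x y).
Proof.
  intros Hw Hw' (g & Hg & _ & Hp) Hx Hy.
  destruct (stage_position w x Hw Hx) as (p & Hpx).
  destruct (stage_position w y Hw Hy) as (q & Hqy).
  rewrite (before_iff w p q), (before_iff w' (g p) (g q)); auto.
  apply nth_error_lt in Hpx, Hqy.
  destruct (Nat.lt_trichotomy p q) as [H|[->|H]]; [| |];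
    [specialize (Hg p q)| |specialize (Hg q p)]; lia.
Qed.

Lemma before_later s s' x y : s <= s' ->
  x < length (order_at I s) -> y < length (order_at I s) ->
  (before (order_at I s) x y <-> before (order_at I s') x y).
Proof.
  intros Hs Hx Hy.
  enough (H : length (order_at I s) <= length (order_at I s') /\
    (before (order_at I s) x y <-> before (order_at I s') x y)) by tauto.
  induction Hs as [|s' Hs [IH1 IH2]]; [split; [auto|tauto]|].
  destruct (order_extends s') as (r & Hr).
  assert (H1 := order_stage s'). assert (H2 := order_stage (S s')).
  split.
  - destruct Hr as (g & Hg & _ & Hp).
    destruct (Nat.eq_dec (length (order_at I s')) 0) as [|Hne]; [lia|].
    destruct (nth_error_ex (order_at I s') (length (order_at I s') - 1))
      as (z & Hz); [lia|].
    apply Hp, nth_error_lt in Hz.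
    assert (H := incr_on_ge _ _ Hg (length (order_at I s') - 1)). lia.
  - rewrite IH2. apply (before_extends r); auto; lia.
Qed.

Lemma settled_prefix T s0 s : settled T s0 -> s0 <= s ->
  prefix (current T) (order_at I s).
Proof.
  intros HT Hs. destruct (HT s Hs) as (l & El). unfold order_at.
  assert (H := proj1 (run_ok s)). rewrite El in *.
  apply (stack_ok_prefix l T H).
Qed.

Lemma settled_ok T s0 : settled T s0 -> stack_ok T.
Proof.
  intros HT. destruct (HT s0 ltac:(lia)) as (l & El).
  assert (H := proj1 (run_ok s0)). rewrite El in H.
  apply (stack_ok_prefix l T H).
Qed.

(** Each settled entry lengthens the permanent initial segment by at least one element. Hence the
    limit has order type omega. *)
Lemma stable_prefix n : exists w s0, stage f w /\ n <= length w /\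
  forall s, s0 <= s -> prefix w (order_at I s).
Proof.
  destruct (settled_all n) as (T & s0 & Hl & HT).
  assert (Hok := settled_ok T s0 HT).
  exists (current T), s0. split; [|split].
  - apply stack_ok_stage, Hok.
  - apply stack_ok_length in Hok. lia.
  - intros s. apply settled_prefix, HT.
Qed.

Definition in_limit (p x : nat) : Prop :=
  exists s0, forall s, s0 <= s -> nth_error (order_at I s) p = Some x.

Lemma prefix_in_limit w s0 p x : (forall s, s0 <= s -> prefix w (order_at I s)) ->
  nth_error w p = Some x -> in_limit p x.
Proof. intros H Hp. exists s0. intros s Hs. apply (H s Hs), Hp. Qed.

Lemma in_limit_fun p x y : in_limit p x -> in_limit p y -> x = y.
Proof.
  intros (s & Hs) (s' & Hs'). specialize (Hs (s + s') ltac:(lia)).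
  specialize (Hs' (s + s') ltac:(lia)). congruence.
Qed.

Lemma in_limit_inj p q x : in_limit p x -> in_limit q x -> p = q.
Proof.
  intros (s & Hs) (s' & Hs'). specialize (Hs (s + s') ltac:(lia)).
  specialize (Hs' (s + s') ltac:(lia)).
  apply (nth_error_inj (order_at I (s + s')) p q x); auto. apply order_stage.
Qed.

Lemma limit_position x : exists p, in_limit p x.
Proof.
  destruct (stable_prefix (S x)) as (w & s0 & Hw & Hl & H).
  destruct (stage_position w x Hw) as (p & Hp); [lia|].
  eauto using prefix_in_limit.
Qed.

Lemma limit_element p : exists x, in_limit p x.
Proof.
  destruct (stable_prefix (S p)) as (w & s0 & Hw & Hl & H).
  destruct (nth_error_ex w p) as (x & Hx); [lia|].
  eauto using prefix_in_limit.
Qed.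

Definition position (x : nat) : nat :=
  proj1_sig (constructive_indefinite_description _ (limit_position x)).

Lemma in_limit_position x : in_limit (position x) x.
Proof.
  exact (proj2_sig (constructive_indefinite_description _ (limit_position x))).
Qed.

Lemma position_eq p x : in_limit p x -> position x = p.
Proof. intros H. exact (in_limit_inj _ _ _ (in_limit_position x) H). Qed.

Lemma run_prec_position x y : run_prec x y <-> position x < position y.
Proof.
  destruct (in_limit_position x) as (s1 & H1).
  destruct (in_limit_position y) as (s2 & H2).
  set (s := S (x + y) + s1 + s2).
  assert (Hl := proj2 (run_ok (S (x + y)))).
  unfold run_prec. rewrite (before_later _ s) by lia.
  apply before_iff; [apply order_stage|apply H1; lia|apply H2; lia].
Qed.

Definition run_copy : omega_copy.
Proof.
  refine (OmegaCopy (fun _ => True) run_prec position _ _ _ _).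
  - auto.
  - intros x y _ _ E. apply (in_limit_fun (position x)).
    + apply in_limit_position.
    + rewrite E. apply in_limit_position.
  - intros p. destruct (limit_element p) as (x & Hx).
    exists x. split; [auto|]. apply position_eq, Hx.
  - intros x y _ _. apply run_prec_position.
Defined.

Lemma transport_run_copy x y :
  transport f run_copy (to_nat (x, y)) <-> position y = f (position x).
Proof.
  split.
  - intros (x' & y' & E & _ & _ & H). apply to_nat_inj in E.
    injection E as -> ->. exact H.
  - intros H. exists x, y. cbn. auto.
Qed.

Lemma transport_graph_on w s0 x y : stage f w ->
  (forall s, s0 <= s -> prefix w (order_at I s)) ->
  x < length w -> y < length w ->
  (transport f run_copy (to_nat (x, y)) <-> graph_on f w x y).
Proof.
  intros Hw H Hx Hy. rewrite transport_run_copy.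
  destruct (stage_position w x Hw Hx) as (p & Hp).
  destruct (stage_position w y Hw Hy) as (q & Hq).
  rewrite (position_eq p x), (position_eq q y) by eauto using prefix_in_limit.
  split.
  - intros ->. exists p. auto.
  - intros (p' & Hp' & Hq'). destruct Hw as (Hnd & _).
    rewrite <- (nth_error_inj _ _ _ _ Hnd Hp Hp') in Hq'.
    apply (nth_error_inj _ _ _ _ Hnd Hq Hq').
Qed.

Lemma transport_join_agree w s0 k A B : stage f w ->
  (forall s, s0 <= s -> prefix w (order_at I s)) -> k <= length w -> agree k A B ->
  agree k (join (graph_of_rel (graph_on f w)) A) (join (transport f run_copy) B).
Proof.
  intros Hw H Hk HA. apply join_agree; [|auto]. intros n Hn.
  destruct (of_nat n) as (x, y) eqn:E.
  assert (n = to_nat (x, y)) as -> by now rewrite <- E, cancel_to_of.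
  destruct (to_nat_ge x y).
  rewrite (transport_graph_on w s0) by (auto; lia).
  split; [|exists x, y; auto]. intros (x' & y' & E' & H').
  apply to_nat_inj in E'. injection E' as -> ->. auto.
Qed.

(** * Every final phase of an entry contradicts the two reductions *)

Section Verification.
Context (N : nat) (HN : forall a b, N <= a -> is_block f a b ->
  exists c d, is_block f c d /\ b < c /\ block_embeds f a b c d).
Context (HNbase0 : N <= length base0).
Context (f_moves : forall m, exists p, m <= p /\ f p <> p).
Context (T : list entry) (r : entry) (s0 : nat) (Hsettled : settled (r :: T) s0).

Local Notation i := (length T).
Local Notation fL := (join (transport f run_copy) (bits I)).

Lemma settled_inert s : s0 <= s ->
  ~ exists r', reacts s (cutoff I s) i (current T) (order_at I s) r r'.
Proof.
  intros Hs. apply (settled_quiet (r :: T) s0 s Hsettled Hs []). auto.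
Qed.

Lemma settled_entry : stack_ok T /\ stage f (current T) /\ stage f (fst r) /\
  prefix (current T) (fst r) /\ entry_ok i (current T) r /\
  N <= length (current T) /\ forall s, s0 <= s -> prefix (fst r) (order_at I s).
Proof.
  destruct (settled_ok _ _ Hsettled) as (H1 & H2 & H3 & _ & H4).
  assert (Hl := stack_ok_length _ H1).
  do 2 (split; [auto using stack_ok_stage|]). do 3 (split; [auto|]).
  split; [lia|]. intros s Hs.
  assert (H := settled_prefix _ _ _ Hsettled Hs). now destruct r.
Qed.

Context (HPhi : forall n y, charf (X (req_index i)) n y -> eval fL (req_Phi i) n y).
Context (HPsi : forall n y, charf fL n y -> eval (X (req_index i)) (req_Psi i) n y).

(** The stored order is permanent, so Phi computes the guess from f^L and the guess is correct. Then
    the approximation eventually matches it, and [destroy] allows a diversion. *)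
Lemma not_armed a : snd r <> Armed a.
Proof.
  intros Er.
  destruct settled_entry as (_ & H1 & H2 & H3 & H4 & H5 & H6).
  unfold entry_ok in H4. rewrite Er in H4.
  destruct H4 as (K1 & K2 & K3 & K4 & K5 & K6).
  destruct (approx_below (req_index i) (att_use a)) as (s1 & Hs1).
  apply (settled_inert (s0 + s1)); [lia|].
  assert (Hp : prefix (fst r) (order_at I (s0 + s1))) by (apply H6; lia).
  assert (Hst := order_stage (s0 + s1)).
  destruct (graph_on_lt _ _ _ H2 K5) as [Hx Hy].
  destruct (destroy f f_block (current T) (order_at I (s0 + s1))
    (att_arg a) (att_val a)) as (w' & L1 & L2 & L3 & L4 & L5); auto.
  { eapply prefix_trans; eauto. }
  { apply (graph_on_prefix f (fst r)); auto. }
  exists (w', Diverted a (order_at I (s0 + s1))).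
  do 3 (split; [auto|]). rewrite Er. split; [auto|]. split; [|auto].
  intros z Hz. rewrite Hs1 by lia.
  apply (eval_fun (req_Phi i) fL z); [apply HPhi, charf_chi|].
  apply K6; [|auto]. apply (transport_join_agree (fst r) s0); auto.
  intros n; tauto.
Qed.

(** If the approximation matched the guess in the limit, Psi would compute from X a value of f^L
    that the permanent diverted order refutes. So it differs from the guess, and [restore] allows an
    action. *)
Lemma not_diverted a c : snd r <> Diverted a c.
Proof.
  intros Er.
  destruct settled_entry as (_ & H1 & H2 & H3 & H4 & H5 & H6).
  unfold entry_ok in H4. rewrite Er in H4.
  destruct H4 as ((K1 & K2 & K3 & K4 & K5 & K6) & L1 & L2 & (t & L3) & L4).
  destruct (approx_below (req_index i) (att_use a)) as (s1 & Hs1).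
  apply (settled_inert (s0 + s1)); [lia|].
  assert (Hp : prefix (fst r) (order_at I (s0 + s1))) by (apply H6; lia).
  assert (Hst := order_stage (s0 + s1)).
  destruct (restore f f_block N HN (current T) c (order_at I (s0 + s1)) t)
    as (w' & M1 & M2 & M3 & M4); auto.
  { intros p x Hx. apply Hp, L3, Hx. }
  exists (w', Armed a). do 3 (split; [auto|]). rewrite Er.
  split; [auto|]. split; [|auto]. apply NNPP. intros Hn.
  assert (Hg : forall z, z < att_use a ->
    chi (X (req_index i)) z = att_guess a z).
  { intros z Hz. rewrite <- (Hs1 (s0 + s1)) by lia. apply NNPP. eauto. }
  assert (Hev := K3 _ Hg). enough (0 = 1) by lia.
  eapply eval_fun; [|exact Hev]. apply HPsi. right. split; [|auto].
  rewrite join_l. destruct K5 as (p & Hp1 & Hp2). apply L3 in Hp1, Hp2.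
  destruct H2 as (N1 & N2 & N3).
  rewrite (transport_graph_on (fst r) s0); auto;
    [split; auto| |]; apply N2; eauto using nth_error_In.
Qed.

(** [f] moves a point above [base], and the two reductions supply the uses. In the limit all
    conditions for an attack hold, hence also at some finite stage. *)
Lemma not_waiting : snd r <> Waiting.
Proof.
  intros Er.
  destruct settled_entry as (H0 & H1 & H2 & H3 & _ & _ & H6).
  destruct (f_moves (length (current T))) as (p & Hp & Hfp).
  destruct (limit_element p) as (x & Hx), (limit_element (f p)) as (y & Hy).
  assert (Hxy : transport f run_copy (to_nat (x, y))).
  { rewrite transport_run_copy, (position_eq p x), (position_eq (f p) y); auto. }
  destruct (eval_use (req_Psi i) (X (req_index i)) (2 * to_nat (x, y)) 1)
    as (u & Hu).
  { apply HPsi. left. split; [|auto]. now apply join_l. }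
  destruct (bounded_choice (fun z v => forall B, agree v fL B ->
    eval B (req_Phi i) z (chi (X (req_index i)) z)) u) as (v & Hv).
  { intros z v v' Hvv' H B HB. apply H. eapply agree_le; eauto. }
  { intros z _. apply eval_use, HPhi, charf_chi. }
  (* This permanent segment contains [x], [y] and all elements below the use [v] of Phi. *)
  destruct (stable_prefix (v + S x + S y)) as (w & s1 & Hw & Hlw & Hpw).
  destruct (approx_below (req_index i) u) as (s2 & Hs2).
  (* At this stage the segment [w] and the approximation below [u] are final, and [s] exceeds both
     uses, as an attack demands. *)
  set (s := s0 + s1 + s2 + u + v).
  destruct Hx as (s3 & Hx'). assert (Hx : in_limit p x) by (exists s3; auto).
  apply (settled_inert s); [lia|].
  assert (Hst := order_stage s).
  destruct (grow f f_block (order_at I s) Hst) as (w' & G1 & G2 & G3).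
  assert (Hww' : prefix w w').
  { eapply prefix_trans; [|exact G3]. apply Hpw. lia. }
  assert (Hg := graph_on_prefix f w w' Hw G1 Hww').
  exists (w', Armed (Attack s u (chi (X (req_index i))) x y)).
  split; [auto|]. split; [auto|]. split.
  { exists (fun q => q). split; [intros q q' _ H _; exact H|auto]. }
  rewrite Er. exists (Attack s u (chi (X (req_index i))) x y).
  split; [auto|]. split; [auto|].
  unfold psi_sees, phi_forces. cbn -[Nat.mul].
  split; [lia|]. split; [|split; [|split; [|split; [|split]]]].
  - intros z Hz. apply Hs2; lia.
  - intros ->. apply Hfp. symmetry. eapply in_limit_inj; eauto.
  - intros Hin. apply In_nth_error in Hin as (q & Hq).
    assert (q = p) as ->.
    { apply (in_limit_inj _ _ x); [|auto]. apply (prefix_in_limit (current T) s0);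
        auto. intros t Ht. eapply prefix_trans; [exact H3|auto]. }
    apply nth_error_lt in Hq. lia.
  - apply Hg; [lia|lia|]. apply (transport_graph_on w s1); auto; lia.
  - intros B HB. apply Hu. intros z Hz. specialize (HB z Hz).
    rewrite <- (chi_iff B), HB. symmetry. apply chi_iff.
  - intros B HB z Hz. apply Hv; [auto|].
    eapply agree_trans; [|apply (agree_le v s); [lia|exact HB]].
    eapply agree_trans.
    { apply agree_sym, (transport_join_agree w s1 v (bits (cutoff I s)));
        auto; [lia|]. apply (agree_le v s); [lia|apply bits_cutoff]. }
    apply join_agree; [|intros n _; tauto].
    intros n Hn. unfold graph_of_rel.
    split; intros (x' & y' & -> & Hxy'); exists x', y'; (split; [auto|]);
      destruct (to_nat_ge x' y'); apply Hg; auto; lia.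
Qed.

Lemma requirement_refuted : False.
Proof.
  destruct (snd r) as [|a|a c] eqn:E.
  - exact (not_waiting E).
  - exact (not_armed a E).
  - exact (not_diverted a c E).
Qed.
End Verification.

End Run.
End Construction.

(** Starting beyond [N] ensures that all blocks above the initial order embed into later ones. *)
Lemma base_stage f (f_block : block_function f) N :
  exists base, stage f base /\ N <= length base.
Proof.
  destruct (cuts_unbounded f f_block N) as (m & Hm & Hc).
  exists (seq 0 m). rewrite length_seq. split; [|lia].
  split; [apply seq_NoDup|]. rewrite length_seq. split; [|auto].
  intros x. rewrite in_seq. lia.
Qed.

Theorem theorem4p4
  (f : nat -> nat)
  (f_block : block_function f)
  (f_not_ic : ~ intrinsically_computable_on_a_cone f)
  (f_embeds : eventually_blocks_embed_later f)
  (Gamma : functional)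
  (Gamma_total : forall (A : nat -> Prop) (e x s : nat),
    exists y, (y = 0 \/ y = 1) /\ eval3 Gamma A e x s y)
  (Gamma_lim : forall (A : nat -> Prop) (e x : nat),
    exists y, has_limit Gamma A e x y)
  (Gamma_above : forall (A : nat -> Prop) (e : nat),
    turing_le A (limit_set Gamma A e)) :
  exists Z : nat -> Prop, forall A : nat -> Prop, turing_le Z A ->
    exists d : degree, DgSp A f d /\
      forall e : nat, d <> deg (limit_set Gamma A e).
Proof.
  assert (f_moves : forall m, exists p, m <= p /\ f p <> p).
  { intros m. apply NNPP. intros H. apply f_not_ic.
    apply (eventually_id_intrinsically_computable f m).
    intros p Hp. apply NNPP. eauto. }
  destruct f_embeds as (N & HN).
  destruct (base_stage f f_block N) as (base & Hbase & HNbase).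
  (* The order of [x] and [y] is fixed by stage [x + y + 1], which reads finitely many values of the
     oracle; so the map from oracles to limit orders is continuous. *)
  destruct (continuous_computable
    (fun I => chi (graph_of_rel (run_prec f base I)))) as (Z & HZ).
  { intros n. destruct (of_nat n) as (x, y) eqn:E.
    assert (n = to_nat (x, y)) as -> by now rewrite <- E, cancel_to_of.
    destruct (run_continuous f base (S (x + y))) as (m & Hm).
    exists m. intros I J H. apply chi_ext. unfold graph_of_rel.
    split; intros (x' & y' & E' & H'); exists x', y'; (split; [auto|]);
      apply to_nat_inj in E'; injection E' as <- <-;
      unfold run_prec, order_at in *; [rewrite <- (Hm I J)|rewrite (Hm I J)]; auto. }
  exists Z. intros A HA.
  set (gam := fun k => let e := fst (of_nat k) in
    let x := fst (of_nat (snd (of_nat k))) in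
    let s := snd (of_nat (snd (of_nat k))) in
    proj1_sig (constructive_indefinite_description _ (Gamma_total A e x s))).
  assert (Hgam : forall e x s, let y := gam (to_nat (e, to_nat (x, s))) in
    (y = 0 \/ y = 1) /\ eval3 Gamma A e x s y).
  { intros e x s. unfold gam. rewrite !cancel_of_to. cbn [fst snd].
    rewrite !cancel_of_to. cbn [fst snd].
    exact (proj2_sig (constructive_indefinite_description _ (Gamma_total A e x s))). }
  set (I := fun k => to_nat (chi A k, gam k)).
  assert (HI : comp A I).
  { apply comp_pair; [apply turing_le_comp, turing_le_refl|].
    exists Gamma. intros k.
    destruct (of_nat k) as (e, q) eqn:Ek, (of_nat q) as (x, s) eqn:Eq.
    assert (q = to_nat (x, s)) as -> by now rewrite <- Eq, cancel_to_of.
    assert (k = to_nat (e, to_nat (x, s))) as -> by now rewrite <- Ek, cancel_to_of.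
    apply Hgam. }
  assert (Hbits : bits I = A).
  { apply functional_extensionality. intros n.
    apply propositional_extensionality. unfold bits, I.
    rewrite cancel_of_to. apply chi_iff. }
  assert (HX : forall e x, exists s0, forall s, s0 <= s ->
    approx I e x s = chi (limit_set Gamma A e) x).
  { intros e x. destruct (Gamma_lim A e x) as (y & s0 & Hs0).
    assert (Hy : forall s, s0 <= s -> approx I e x s = y).
    { intros s Hs. unfold approx, I. rewrite cancel_of_to. cbn [snd].
      eapply eval_fun; [apply Hgam|apply Hs0, Hs]. }
    exists s0. intros s Hs. rewrite (Hy s Hs).
    assert (Hlim : limit_set Gamma A e x <-> y = 1).
    { split; [|intros ->; exists s0; auto].
      intros (s1 & Hs1). apply (eval_fun Gamma A (to_nat (e, to_nat (x, s0 + s1))));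
        [apply Hs0|apply Hs1]; lia. }
    assert (H01 : y = 0 \/ y = 1).
    { rewrite <- (Hy s0) by auto. unfold approx, I. rewrite cancel_of_to.
      apply Hgam. }
    unfold chi. destruct excluded_middle_informative; tauto. }
  set (L := run_copy f f_block base Hbase I (limit_set Gamma A) HX).
  exists (deg (join (transport f L) A)). split.
  - exists L. split; [|auto]. split; apply turing_le_comp.
    + destruct (comp_const A 1) as (c & Hc). exists c. intros n.
      replace (chi (carrier L) n) with 1; [apply Hc|].
      symmetry. now apply chi_iff.
    + apply HZ; auto.
  (* Equal degrees give reductions both ways, and the requirement indexed by [e] and this pair is
     refuted. *)
  - intros e He. apply deg_inj in He as ((Psi & HPsi) & (Phi & HPhi)).
    destruct (req_ex e Phi Psi) as (i & <- & <- & <-).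
    destruct (settled_all f f_block base Hbase I _ HX i)
      as (T & s0 & <- & HT).
    destruct (settled_succ f f_block base Hbase I _ HX T s0 HT)
      as (r & s1 & Hr).
    apply (requirement_refuted f f_block base Hbase I _ HX N HN HNbase f_moves
      T r s1 Hr); rewrite Hbits; assumption.
Qed.
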